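(* Suppose that $\lambda$ is a regular uncountable cardinal such that $\diamondsuit(\lambda)$ and $\boxed{\diamondsuit}_\lambda$ both hold. Then there exists a family $\langle\mathbf T^i\mid i<2^{\lambda^{+}}\rangle$ of splitting, binary, full $\lambda^+$-Souslin trees such that for every nonempty $I\subseteq 2^{\lambda^{+}}$ with $|I|<\lambda$, the product $\bigotimes_{i\in I}\mathbf T^i$ is again a $\lambda^+$-Souslin tree.
   Context: Trees. Let $\kappa$ be a regular uncountable cardinal. A partially ordered set $\mathbf T=(T,<_T)$ is a $\kappa$-tree iff: (1) for every $x\in T$, the set $x_\downarrow:=\{y\in T\mid y<_T x\}$ is well-ordered by $<_T$; write $\mathrm{ht}(x):=\mathrm{otp}(x_\downarrow,<_T)$; (2) for every $\alpha<\kappa$, the level $T_\alpha:=\{x\in T\mid \mathrm{ht}(x)=\alpha\}$ is nonempty and has size less than $\kappa$, and the level $T_\kappa$ is empty. For an ordinal $\alpha$, a subset $B\subseteq T$ is an $\alpha$-branch iff $B$ is linearly ordered by $<_T$ and $\{\mathrm{ht}(x)\mid x\in B\}=\alpha$. It is vanishing iff there is no $y\in T$ such that $x\le_T y$ for all $x\in B$. A $\kappa$-tree is full iff for every limit ordinal $\alpha<\kappa$ it has at most one vanishing $\alpha$-branch. A $\kappa$-tree is $\kappa$-Souslin iff it has no $\kappa$-branches and no antichains (sets of pairwise incomparable nodes) of size $\kappa$. A splitting binary $\kappa$-tree is a $\kappa$-tree of the form $(T,\subseteq)$, where $T$ is a subset of ${}^{<\kappa}2$ that is closed under initial segments and satisfies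 $t\cup\{(\mathrm{dom}(t),0)\},t\cup\{(\mathrm{dom}(t),1)\}\in T$ for every $t\in T$. Products. For $\kappa$-trees $\mathbf T^i=(T^i,<_{T^i})$ $(i\in I)$, the product $\bigotimes_{i\in I}\mathbf T^i$ is the poset with underlying set $\bigcup\{\prod_{i\in I}(T^i)_\alpha\mid\alpha<\kappa\}$, ordered by $\vec s<\vec t$ iff $\vec s(i)<_{T^i}\vec t(i)$ for every $i\in I$. Prediction principles. $\diamondsuit(\lambda)$ asserts the existence of a sequence $\langle f_\beta\mid\beta<\lambda\rangle$ such that for every function $f:\lambda\to\lambda$, the set $\{\beta<\lambda\mid f\restriction\beta=f_\beta\}$ is stationary in $\lambda$. For a set of ordinals $C$, $\mathrm{acc}(C):=\{\alpha\in C\mid\sup(C\cap\alpha)=\alpha>0\}$. The principle $\boxed{\diamondsuit}_\lambda$ (square with built-in diamond) asserts the existence of a sequence $\langle(C_\alpha,X_\alpha)\mid\alpha<\lambda^+\rangle$ such that: (1) for every $\alpha<\lambda^+$, $C_\alpha$ is a closed subset of $\alpha$ with $\sup(C_\alpha)=\sup(\alpha)$ and $\mathrm{otp}(C_\alpha)\le\lambda$, and $X_\alpha\subseteq\alpha$; (2) for every $\alpha<\lambda^+$ and every $\beta\in\mathrm{acc}(C_\alpha)$, $C_\beta=C_\alpha\cap\beta$ and $X_\beta=X_\alpha\cap\beta$; (3) for every $X\subseteq\lambda^+$ and every club $E\subseteq\lambda^+$, there exists a limit ordinal $\alpha<\lambda^+$ with $\mathrm{otp}(C_\alpha)=\lambda$,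 $X_\alpha=X\cap\alpha$ and $\mathrm{acc}(C_\alpha)\subseteq E$. *)

(* Defs.v *)
From mathcomp Require Import all_boot all_order.
From mathcomp Require Import boolp classical_sets functions cardinality.
From mathcomp Require wochoice.

Set Implicit Arguments.
Unset Strict Implicit.
Unset Printing Implicit Defensive.

Local Open Scope order_scope.
Local Open Scope card_scope.
Local Open Scope classical_set_scope.

(* An ordinal is a well-ordered type K; the ordinals a < K are its elements,
   and a : K, as a von Neumann ordinal, is the initial segment [below a]. *)

Definition below d (K : orderType d) (a : K) : set K := [set b | b < a].

(* otp (A, r) = otp (B, s) *)
Definition same_otp X Y (r : X -> X -> Prop) (A : set X)
    (s : Y -> Y -> Prop) (B : set Y) : Prop :=
  exists f : A -> B, bijective f /\
    forall x y : A, r (val x) (val y) <-> s (val (f x)) (val (f y)).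

Definition ord_lt d (K : orderType d) (a b : K) : Prop := a < b.

Definition card_lt X Y (A : set X) (B : set Y) : Prop :=
  A #<= B /\ ~ (B #<= A).

(* K is an initial ordinal *)
Definition is_cardinal d (K : orderType d) : Prop :=
  wochoice.well_order (<=%O : rel K) /\ forall a : K, card_lt (below a) [set: K].

Definition cofinal d (K : orderType d) (A : set K) : Prop :=
  forall b : K, exists2 a, A a & b <= a.

Definition regular_uncountable d (K : orderType d) : Prop :=
  [/\ is_cardinal K, ~ countable [set: K] &
      forall A : set K, cofinal A -> A #= [set: K]].

Definition is_succ_cardinal dL (L : orderType dL) dK (K : orderType dK) : Prop :=
  [/\ is_cardinal K, card_lt [set: L] [set: K] &
      forall a : K, below a #<= [set: L]].

(* K is the cardinal 2^X *)
Definition is_power_cardinal (X : Type) d (K : orderType d) : Prop :=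
  is_cardinal K /\ [set: K] #= [set: X -> bool].

(* sup (C `&` a) = a > 0 *)
Definition limit_point d (K : orderType d) (C : set K) (a : K) : Prop :=
  supremums (C `&` below a) a /\ exists b : K, b < a.

Definition acc d (K : orderType d) (C : set K) : set K :=
  [set a | C a /\ limit_point C a].

Definition is_limit d (K : orderType d) (a : K) : Prop :=
  limit_point [set: K] a.

(* C is a closed subset of D, for D = below a or D = [set: K] *)
Definition closed_in d (K : orderType d) (D C : set K) : Prop :=
  C `<=` D /\ forall a, D a -> limit_point C a -> C a.

Definition club d (K : orderType d) (C : set K) : Prop :=
  closed_in [set: K] C /\ forall b : K, exists2 a, C a & b < a.

Definition stationary d (K : orderType d) (S : set K) : Prop :=
  forall E : set K, club E -> S `&` E !=set0.

Definition diamond d (L : orderType d) : Prop :=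
  exists g : forall b : L, below b -> L,
    forall f : L -> L,
      stationary [set b | (fun x : below b => f (val x)) = g b].

Definition boxed_diamond dL (L : orderType dL) dK (K : orderType dK) : Prop :=
  exists (C X : K -> set K),
    [/\ (* As subsets of K, both sides of the second equation are singletons,
           and the supremum of the empty set is 0. *)
        forall a, [/\ closed_in (below a) (C a),
                      supremums (C a) = supremums (below a),
                      same_otp (@ord_lt _ K) (C a) (@ord_lt _ L) [set: L] \/
                        (exists l : L,
                           same_otp (@ord_lt _ K) (C a) (@ord_lt _ L) (below l))
                    & X a `<=` below a],
        forall a b, acc (C a) b ->
          C b = C a `&` below b /\ X b = X a `&` below b
      & forall Y E : set K, club E ->
          exists a, [/\ is_limit a,
                        same_otp (@ord_lt _ K) (C a) (@ord_lt _ L) [set: L],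
                        X a = Y `&` below a
                      & acc (C a) `<=` E]].

Record rstruct := Rstruct { node :> Type ; prec : node -> node -> Prop }.

Definition has_height d (K : orderType d) (T : rstruct) (x : T) (a : K) : Prop :=
  same_otp (@prec T) [set y | prec y x] (@ord_lt _ K) (below a).

Definition level d (K : orderType d) (T : rstruct) (a : K) : set T :=
  [set x | has_height x a].
Arguments level {d K} T a.

Definition kappa_tree d (K : orderType d) (T : rstruct) : Prop :=
  [/\ (forall x : T, ~ prec x x) /\
        (forall x y z : T, prec x y -> prec y z -> prec x z),
      forall (x : T) (B : set T), B `<=` [set y | prec y x] -> B !=set0 ->
        exists2 y, B y & forall z, B z -> z = y \/ prec y z,
      forall a : K, level T a !=set0 /\ card_lt (level T a) [set: K]
    & forall x : T,
        ~ same_otp (@prec T) [set y | prec y x] (@ord_lt _ K) [set: K]].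

(* The ordinal of heights of B is given as D = below a or D = [set: K]. *)
Definition branch d (K : orderType d) (T : rstruct) (D : set K) (B : set T) :
    Prop :=
  [/\ forall x y, B x -> B y -> [\/ x = y, prec x y | prec y x],
      forall x, B x -> exists2 a, D a & has_height x a
    & forall a, D a -> exists2 x, B x & has_height x a].

Definition vanishing (T : rstruct) (B : set T) : Prop :=
  ~ exists y : T, forall x, B x -> x = y \/ prec x y.

Definition full d (K : orderType d) (T : rstruct) : Prop :=
  forall a : K, is_limit a -> forall B B' : set T,
    branch (below a) B -> vanishing B ->
    branch (below a) B' -> vanishing B' -> B = B'.

Definition antichain (T : rstruct) (A : set T) : Prop :=
  forall x y, A x -> A y -> x <> y -> ~ prec x y /\ ~ prec y x.

Definition souslin d (K : orderType d) (T : rstruct) : Prop :=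
  [/\ kappa_tree K T,
      ~ exists B : set T, branch [set: K] B
    & ~ exists A : set T, antichain A /\ A #= [set: K]].

(* A function from an ordinal a < K to 2 is represented by its graph. *)
Definition has_dom d (K : orderType d) (t : set (K * bool)) (a : K) : Prop :=
  [set p.1 | p in t] = below a.

Definition seq2 d (K : orderType d) : set (set (K * bool)) :=
  [set t | (forall b i j, t (b, i) -> t (b, j) -> i = j) /\
           exists a, has_dom t a].

Definition inclusion_order d (K : orderType d) (T : set (set (K * bool))) :
    rstruct :=
  @Rstruct T (fun s t => val s `<` val t).

Definition splitting_binary_tree d (K : orderType d)
    (T : set (set (K * bool))) : Prop :=
  [/\ kappa_tree K (inclusion_order T),
      T `<=` @seq2 _ K,
      forall t (b : K), T t -> T (t `&` [set p | p.1 < b])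
    & forall t a, T t -> has_dom t a ->
        T (t `|` [set (a, false)]) /\ T (t `|` [set (a, true)])].

Definition product d (K : orderType d) (J : Type) (T : J -> rstruct) : rstruct :=
  @Rstruct [set s : forall j, T j | exists a : K, forall j, level (T j) a (s j)]
    (fun s t => forall j, prec (val s j) (val t j)).

(* Main.v *)
(* Identify M with a set of functions g : K -> bool and build, by recursion on the
   level and simultaneously for all g, trees T^g whose levels up to a depend only on
   the restriction of g to a. At a limit level a all branches of the tree below are
   kept, with at most one exception, so the trees are full. To decide on the
   exception, thin out C_a to D_a = acc (C_a). A branch t is called canonical if from
   some point of D_a on its values along D_a follow a walk determined by C and X; if
   D_a has order type z < lambda, then the branch coded by the z-th guess of
   diamond(lambda) is removed unless it is canonical. If D_a has order type lambda, a
   branch that is not canonical would have been guessed, hence removed, at some limit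
   point of D_a; so all branches are canonical, there are at most lambda of them, and
   none is removed.
   The step of the walk from a limit point c of D_a to the next point n of D_a decodes
   from X_a below n a family g_j (j in J, |J| < lambda) and a part of a dense set S of
   the product of the T^(g_j), and from diamond(lambda) a guess of a vector of nodes at
   level c; it moves the nodes of this vector jointly above an element of S. When
   otp (C_a) = lambda and X_a and D_a come from the guessing property of the boxed
   diamond, every vector of level a consists of canonical branches, so it is guessed by
   diamond(lambda) at some c, and lies above an element of S. Thus every dense
   open set of a product contains a whole level, whence the product is Souslin. *)

Require Import Defs.
From mathcomp Require Import all_boot all_order.
From mathcomp Require Import boolp classical_sets functions cardinality.
From mathcomp Require wochoice.

Set Implicit Arguments.
Unset Strict Implicit.
Unset Printing Implicit Defensive.

Import Order.TTheory.
Local Open Scope order_scope.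
Local Open Scope card_scope.
Local Open Scope classical_set_scope.

(** * Choice with a default value, and cardinal comparison through total functions *)

Definition eps T (x0 : T) (P : T -> Prop) : T :=
  if pselect (exists x, P x) is left h then sval (cid h) else x0.

Lemma epsP T (x0 : T) (P : T -> Prop) : (exists x, P x) -> P (eps x0 P).
Proof. by move=> h; rewrite /eps; case: pselect => // h'; exact: (svalP (cid h')). Qed.

Lemma card_le_injP T U (u0 : U) (A : set T) (B : set U) : A #<= B <->
  exists f : T -> U, (forall x, A x -> B (f x)) /\
    forall x y, A x -> A y -> f x = f y -> x = y.
Proof.
split=> [/card_leP/injfunPex[f _ fI]|[f [fB fI]]].
- pose g x := if pselect (A x) is left h then \val (f (SigSub (mem_set h))) else u0.
  exists g; split=> [x Ax|x y Ax Ay]; rewrite /g.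
  + by case: pselect => // h; exact: set_valP.
  + case: pselect => // hx; case: pselect => // hy /val_inj e.
    by have /(congr1 val) := fI _ _ (mem_set I) (mem_set I) e.
- apply/card_leP/injfunPex.
  have fB' (x : A) : f (\val x) \in B by apply: mem_set; apply: fB; exact: set_valP.
  exists (fun x : A => SigSub (fB' x) : B) => // x y _ _ /(congr1 val) /= e.
  by apply: val_inj; apply: fI e; exact: set_valP.
Qed.

(** * Well-orders and closed unbounded sets *)

Definition wo d (K : orderType d) :=
  forall A : set K, A !=set0 -> exists2 m, A m & forall x, A x -> m <= x.

Definition limp d (K : orderType d) (A : set K) (a : K) : Prop :=
  (exists b, b < a) /\ forall b, b < a -> exists c, [/\ A c, b < c & c < a].

(** Uncountable cofinality; in particular there is no maximum. *)
Definition countably_bounded d (K : orderType d) :=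
  forall s : nat -> K, exists b, forall n, s n < b.

(** Regularity in the form used below: no function on a proper initial segment is cofinal. *)
Definition initially_bounded d (K : orderType d) :=
  forall (f : K -> K) x, exists y, forall c, c < x -> f c < y.

Lemma well_order_wo d (K : orderType d) :
  wochoice.well_order (<=%O : rel K) -> wo K.
Proof.
move=> h A [x Ax].
have e : wochoice.nonempty [pred y | `[< A y >]].
  by exists x; rewrite inE.
have [z [[zA zl] _]] := h _ e.
exists z; first by move: zA; rewrite inE.
by move=> y Ay; apply: zl; rewrite inE.
Qed.

Lemma limit_pointP d (K : orderType d) (C : set K) a : limit_point C a <-> limp C a.
Proof.
split=> [[[_ h] e]|[e h]]; split=> //.
- move=> b ba; apply: contrapT => n.
  have /h : ubound (C `&` below a) b.
    move=> c [Cc ca]; rewrite leNgt; apply/negP => bc; apply: n; by exists c.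
  by rewrite leNgt ba.
- split=> [c [_ /ltW]//|y yu]; rewrite leNgt; apply/negP => /h[c [Cc yc ca]].
  by have := yu c (conj Cc ca); rewrite leNgt yc.
Qed.

Section WellOrder.
Context d (K : orderType d) (K_wo : wo K).

Lemma wo_ind (P : K -> Prop) :
  (forall x, (forall y, y < x -> P y) -> P x) -> forall x, P x.
Proof.
move=> h x; apply: contrapT => nx.
have [m nm mmin] := K_wo (ex_intro (fun y => ~ P y) x nx).
apply: nm; apply: h => y; rewrite ltNge => /negP ym; apply: contrapT => /mmin.
exact: ym.
Qed.

Lemma lt_wf : well_founded (fun x y : K => x < y).
Proof. by move=> x; elim/wo_ind: x => x h; constructor. Qed.

(** The functional receives a total function, equal to [b0] outside [below a], so recursive
    definitions need no dependent types. *)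
Definition wrec B (b0 : B) (F : K -> (K -> B) -> B) : K -> B :=
  Fix lt_wf (fun _ => B) (fun a r =>
    F a (fun b => if pselect (b < a) is left h then r b h else b0)).

Lemma wrecE B (b0 : B) F a : wrec b0 F a =
  F a (fun b => if b < a then wrec b0 F b else b0).
Proof.
rewrite {1}/wrec Fix_eq.
  congr (F a _); apply/funext => b; case: pselect => [->//|].
  by move/negP/negbTE ->.
move=> x f g fg; congr (F x _); apply/funext => b; by case: pselect.
Qed.

Definition succ (a : K) : K := eps a (fun b => a < b /\ forall c, a < c -> b <= c).

Lemma succP a b : a < b -> a < succ a /\ forall c, a < c -> succ a <= c.
Proof.
move=> ab; apply: (epsP a (P := fun b => a < b /\ forall c, a < c -> b <= c)).
by have [m am h] := K_wo (ex_intro (fun c => a < c) b ab); exists m.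
Qed.

Section Unbounded.
Context (K_cb : countably_bounded K) (K_ib : initially_bounded K).

Lemma no_max (a : K) : exists b, a < b.
Proof. by have [b h] := K_cb (fun=> a); exists b; exact: (h 0%N). Qed.

Lemma lt_succ a : a < succ a.
Proof. by have [b ab] := no_max a; have [] := succP ab. Qed.

Lemma succ_le a c : (succ a <= c) = (a < c).
Proof.
apply/idP/idP; first exact/lt_le_trans/lt_succ.
by move=> ac; have [_] := succP ac; apply.
Qed.

Lemma lt_succ_le a c : (c < succ a) = (c <= a).
Proof. by rewrite ltNge succ_le -leNgt. Qed.

Lemma succ_not_limp A a : ~ limp A (succ a).
Proof.
by case=> _ /(_ a (lt_succ a)) [c [_ ac]]; rewrite lt_succ_le leNgt ac.
Qed.

Lemma ord_cases a : [\/ forall b, a <= b, exists b, a = succ b | limp [set: K] a].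
Proof.
have [e|n] := pselect (exists b, b < a); last first.
  constructor 1 => b; rewrite leNgt; apply/negP => ba; apply: n; by exists b.
have [h|n] := pselect (limp [set: K] a); first by constructor 3.
constructor 2; apply: contrapT => m; apply: n; split=> // b ba; exists (succ b).
split=> //; first exact: lt_succ.
rewrite lt_neqAle succ_le ba andbT; apply/eqP => e'; apply: m; by exists b.
Qed.

(** For unboundedness, a bounding function [f] is iterated countably often; the least strict upper
    bound of the iterates is closed under [H]. *)
Lemma closure_club (H : K -> set K) (lb : K) :
  (forall x, exists y, forall c, c <= x -> forall z, H c z -> z < y) ->
  club [set a | lb < a /\ forall c, c < a -> forall z, H c z -> z < a].
Proof.
move=> Hb; split; first split=> // a _ /limit_pointP [[b ba] h].
  split=> [|c ca z Hcz].
    by have [c [[lc _] bc ca]] := h _ ba; exact: lt_trans ca.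
  have [e [[_ he] ce ea]] := h _ ca; exact: lt_trans (he _ ce _ Hcz) ea.
move=> b.
have /boolp.choice[f fP] : forall x, exists y, x < y /\
    forall c, c <= x -> forall z, H c z -> z < y.
  move=> x; have [y hy] := Hb x.
  exists (Order.max y (succ x)); rewrite lt_max lt_succ orbT; split=> // c cx z Hz.
  by rewrite lt_max (hy _ cx).
pose s n := iter n f (Order.max b lb).
have [m0 h0] := K_cb s.
have [m mP mmin] := K_wo (ex_intro (fun a => forall n, s n < a) m0 h0).
have := mP 0%N; rewrite /s /= gt_max => /andP[bm lm].
exists m => //; split=> // c cm z Hz.
have [n cn] : exists n, c <= s n.
  apply: contrapT => nn; have := mmin c; rewrite leNgt cm => /(_ _)/negP; apply=> //.
  by move=> n; rewrite ltNge; apply/negP => cn; apply: nn; exists n.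
exact: lt_trans ((fP (s n)).2 _ cn _ Hz) (mP n.+1).
Qed.

Lemma fun_closure_club (h : K -> K) lb :
  club [set a | lb < a /\ forall c, c < a -> h c < a].
Proof.
have hb x : exists y, forall c, c <= x -> forall z, [set h c] z -> z < y.
  by have [y hy] := K_ib h (succ x); exists y => c cx z ->; apply: hy; rewrite lt_succ_le.
have hc := closure_club lb hb.
have e : [set a | lb < a /\ forall c, c < a -> h c < a] =
  [set a | lb < a /\ forall c, c < a -> forall z, [set h c] z -> z < a].
  apply/seteqP; split=> a [la ha]; split=> // c ca; last exact: (ha c ca _ erefl).
  by move=> z ->; exact: ha.
by rewrite e.
Qed.

End Unbounded.
End WellOrder.

(** Trades the bijection of subtypes for two total functions, mutually inverse on [A] and [B]; [x0]
    and [y0] only fill in values outside these sets. *)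
Lemma same_otpP X Y (x0 : X) (y0 : Y) (r : X -> X -> Prop) (A : set X)
    (s : Y -> Y -> Prop) (B : set Y) : same_otp r A s B <->
  exists (f : X -> Y) (g : Y -> X),
    [/\ forall x, A x -> B (f x) /\ g (f x) = x,
        forall y, B y -> A (g y) /\ f (g y) = y
      & forall x y, A x -> A y -> r x y <-> s (f x) (f y)].
Proof.
split=> [[f [[g fK gK] rs]]|[f [g [fP gP rs]]]].
- pose f' x := if pselect (A x) is left h then \val (f (SigSub (mem_set h))) else y0.
  pose g' y := if pselect (B y) is left h then \val (g (SigSub (mem_set h))) else x0.
  have f'E (x : A) : f' (val x) = val (f x).
    rewrite /f'; case: pselect => [h|[]]; last exact: set_valP.
    by congr (val (f _)); exact: val_inj.
  have g'E (y : B) : g' (val y) = val (g y).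
    rewrite /g'; case: pselect => [h|[]]; last exact: set_valP.
    by congr (val (g _)); exact: val_inj.
  exists f', g'; split=> [x /mem_set Ax|y /mem_set By|x y /mem_set Ax /mem_set Ay].
  + by rewrite -[x]/(val (SigSub Ax : A)) f'E g'E fK; split=> //; exact: set_valP.
  + by rewrite -[y]/(val (SigSub By : B)) g'E f'E gK; split=> //; exact: set_valP.
  + by rewrite -[x]/(val (SigSub Ax : A)) -[y]/(val (SigSub Ay : A)) !f'E.
- have fB (x : A) : f (\val x) \in B by apply/mem_set; exact: (fP _ (set_valP x)).1.
  have gA (y : B) : g (\val y) \in A by apply/mem_set; exact: (gP _ (set_valP y)).1.
  exists (fun x => SigSub (fB x)); split.
    exists (fun y => SigSub (gA y)) => x; apply: val_inj => /=.
      exact: (fP _ (set_valP x)).2.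
    exact: (gP _ (set_valP x)).2.
  by move=> x y /=; apply: rs; exact: set_valP.
Qed.

Lemma is_cardinal_wo d (K : orderType d) : is_cardinal K -> wo K.
Proof. by case=> /well_order_wo. Qed.

(** If [A] below [c] is nonempty without a maximum, its least upper bound is a limit point of [A].
    Were it below [c], it would belong to [A] and be that maximum. *)
Lemma closed_cases d (K : orderType d) (K_wo : wo K) (A : set K) (c : K) :
  (forall b, b < c -> limp A b -> A b) ->
  [\/ limp A c, forall b, A b -> c <= b |
      exists m, [/\ A m, m < c & forall y, A y -> y < c -> y <= m]].
Proof.
move=> Acl.
have [e|ne] := pselect (forall b, A b -> c <= b); first by constructor 2.
have [e|nm] := pselect (exists m, [/\ A m, m < c & forall y, A y -> y < c -> y <= m]).
  by constructor 3.
constructor 1.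
have next y : A y -> y < c -> exists z, [/\ A z, z < c & y < z].
  move=> Ay yc; apply: contrapT => n; apply: nm; exists y; split=> // z Az zc.
  by rewrite leNgt; apply/negP => yz; apply: n; exists z.
have [a0 Aa0 a0c] : exists2 a, A a & a < c.
  apply: contrapT => n; apply: ne => b Ab; rewrite leNgt; apply/negP => bc.
  by apply: n; exists b.
pose U := [set b | forall y, A y -> y < c -> y <= b].
have cU : U c by move=> y _ /ltW.
have [b bU bmin] := K_wo _ (ex_intro _ c cU).
have lb : limp A b.
  split.
    have [z [Az zc a0z]] := next _ Aa0 a0c.
    by exists a0; apply: lt_le_trans a0z _; exact: bU.
  move=> x xb; have [y [Ay yc xy]] : exists y, [/\ A y, y < c & x < y].
    apply: contrapT => n; have := bmin x; rewrite leNgt xb => /(_ _)/negP; apply=> //.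
    move=> y Ay yc; rewrite leNgt; apply/negP => xy; apply: n; by exists y.
  have [z [Az zc yz]] := next _ Ay yc.
  by exists y; split=> //; apply: lt_le_trans yz _; exact: bU.
have := bmin _ cU; rewrite le_eqVlt => /predU1P[<-//|bc].
have [z [Az zc yz]] := next b (Acl _ bc lb) bc.
by have := bU _ Az zc; rewrite leNgt yz.
Qed.

Section Regular.
Context d (L : orderType d) (L_reg : regular_uncountable L).

Lemma regular_wo : wo L.
Proof. by case: L_reg => /is_cardinal_wo. Qed.

(** An unbounded [f] would have a cofinal image, which by regularity has the size of [L]. *)
Lemma regular_bounded T (I : set T) (f : T -> L) :
  card_lt I [set: L] -> exists y, forall c, I c -> f c < y.
Proof.
case: L_reg => _ _ reg [_ nI]; apply: contrapT => n; apply: nI.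
have /reg : cofinal (f @` I).
  move=> b; apply: contrapT => nb; apply: n; exists b => c Ic.
  rewrite ltNge; apply/negP => bc; apply: nb; exists (f c) => //; by exists c.
rewrite card_eq_sym card_eq_le => /andP[h _].
exact: card_le_trans h (card_image_le _ _).
Qed.

Lemma regular_countably_bounded : countably_bounded L.
Proof.
move=> s; have [y h] : exists y, forall n, [set: nat] n -> s n < y.
  apply: regular_bounded; split; last by case: L_reg => _ + _; apply.
  apply/infiniteP => /finite_set_countable; by case: L_reg.
by exists y => n; exact: h.
Qed.

Lemma regular_initially_bounded : initially_bounded L.
Proof.
move=> f x; apply: (regular_bounded (I := below x)).
by case: L_reg => -[_ +] _ _; apply.
Qed.

End Regular.

(** * Arithmetic of the cardinal and its successor *)

Section Diamond.
Context d (L : orderType d) (L_reg : regular_uncountable L) (L_dia : diamond L).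

Let L_wo : wo L := regular_wo L_reg.
Let L_cb : countably_bounded L := regular_countably_bounded L_reg.
Let L_ib : initially_bounded L := regular_initially_bounded L_reg.

Lemma regular_bot : exists b : L, forall l, b <= l.
Proof.
have [x _] : [set: L] !=set0.
  apply/set0P/eqP => e; case: L_reg => _ + _; apply; rewrite e; exact: countable0.
by have [b _ h] := L_wo (ex_intro [set: L] x I); exists b => l; exact: h.
Qed.

(** The closure points of [h] above [lb] form a club, so stationarity supplies a correct guess at
    one of them. This is the only form in which diamond is applied. *)
Lemma diamond_total : exists g : L -> L -> L, forall (f h : L -> L) lb,
  exists z, [/\ lb < z, forall c, c < z -> h c < z
             & forall u, u < z -> g z u = f u].
Proof.
case: L_dia => g gP.
pose g' z u := if pselect (u < z) is left h
  then g z (SigSub (mem_set (h : below z u))) else u.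
exists g' => f h lb.
have [z [fz [lz hz]]] := gP f _ (fun_closure_club L_wo L_cb L_ib h lb).
exists z; split=> // u uz; rewrite /g'; case: pselect => // uz'.
by rewrite -fz.
Qed.

(* The pair (a, b) is coded by an index at which diamond guesses a function with
   values a, b at the first two arguments. *)
Lemma diamond_pairing : exists p : L -> L -> L,
  forall a b a' b', p a b = p a' b' -> a = a' /\ b = b'.
Proof.
have [g gP] := diamond_total; have [u0 _] := regular_bot.
pose u1 := succ u0; have u01 : u0 < u1 by exact: lt_succ.
have ex a b : exists l, g l u0 = a /\ g l u1 = b.
  have [z [lz _ gz]] := gP (fun u => if u == u0 then a else b) id u1.
  exists z; rewrite !gz ?eqxx ?gt_eqF //; exact: lt_trans lz.
exists (fun a b => eps u0 (fun l => g l u0 = a /\ g l u1 = b)) => a b a' b' /= e.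
have [e1 e2] := epsP u0 (ex a b); have [e3 e4] := epsP u0 (ex a' b').
by rewrite -e in e3 e4; split; [rewrite -[LHS]e1 | rewrite -[LHS]e2].
Qed.

(** A function of two variables is guessed as a function of the code [p j u]. The guess is correct
    for all [j, u < z] because [z] is also closed under the pairing, through its bound [hp]. *)
Lemma diamond2 : exists G : L -> L -> L -> L, forall (F : L -> L -> L) h lb,
  exists z, [/\ lb < z, forall c, c < z -> h c < z
             & forall j u, j < z -> u < z -> G z j u = F j u].
Proof.
have [g gP] := diamond_total; have [p pI] := diamond_pairing.
have [l0 _] := regular_bot.
exists (fun z j u => g z (p j u)) => F h lb.
have /boolp.choice[hp hpP] : forall x, exists y, forall a b,
    a <= x -> b <= x -> p a b < y.
  move=> x; have /boolp.choice[ya yaP] : forall a, exists y, forall b, b < succ x -> p a b < y.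
    by move=> a; exact: L_ib.
  have [y hy] := L_ib ya (succ x); exists y => a b ax bx.
  by apply: lt_trans (hy a _); rewrite ?lt_succ_le //; apply: yaP; rewrite lt_succ_le.
pose q1 v := eps l0 (fun a => exists b, p a b = v).
pose q2 v := eps l0 (fun b => exists a, p a b = v).
have q1E a b : q1 (p a b) = a.
  have := epsP l0 (ex_intro (fun a' => exists b', p a' b' = p a b) a (ex_intro _ b erefl)).
  by case=> b' /pI[].
have q2E a b : q2 (p a b) = b.
  have := epsP l0 (ex_intro (fun b' => exists a', p a' b' = p a b) b (ex_intro _ a erefl)).
  by case=> b' /pI[].
have [z [lz hz gz]] := gP (fun v => F (q1 v) (q2 v)) (fun c => Order.max (h c) (hp c)) lb.
exists z; split=> // [c /hz|j u jz uz]; first by rewrite gt_max => /andP[].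
rewrite gz ?q1E ?q2E //.
have : Order.max j u < z by rewrite gt_max jz.
move=> /hz; rewrite gt_max => /andP[_]; apply: lt_trans.
by apply: hpP; rewrite le_max lexx ?orbT.
Qed.

End Diamond.

Section Successor.
Context dL (L : orderType dL) dK (K : orderType dK).
Context (L_reg : regular_uncountable L) (K_succ : is_succ_cardinal L K).
Context (L_dia : diamond L).

Lemma succ_wo : wo K.
Proof. by case: K_succ => /is_cardinal_wo. Qed.

Lemma succ_not_le : ~ ([set: K] #<= [set: L]).
Proof. by case: K_succ => _ []. Qed.

Lemma succ_bot : exists k : K, forall a, k <= a.
Proof.
have [a _] : [set: K] !=set0.
  apply/set0P/eqP => e; apply: succ_not_le; rewrite e; exact: card_ge0.
have [k _ kP] := succ_wo (ex_intro [set: K] a I).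
by exists k => b; exact: kP.
Qed.

Lemma succ_code : exists e : K -> K -> L, forall x c c',
  c <= x -> c' <= x -> e x c = e x c' -> c = c'.
Proof.
have [u0 _] := regular_bot L_reg.
have [p pI] := diamond_pairing L_reg L_dia.
have u01 : u0 != succ u0.
  by rewrite lt_eqF //; apply: lt_succ;
    [exact: regular_wo|exact: regular_countably_bounded].
have /boolp.choice[e eI] : forall x, exists e : K -> L, forall c c',
    c < x -> c' < x -> e c = e c' -> c = c'.
  move=> x; have [_ _ /(_ x)/(card_le_injP u0)[f [_ fI]]] := K_succ.
  by exists f.
(* The given injections live on [below x] only; the first coordinate reserves a separate code for
   [c = x]. *)
exists (fun x c => if c < x then p u0 (e x c) else p (succ u0) u0) => x c c'.
rewrite !le_eqVlt => /predU1P[->|cx] /predU1P[->|cx'] //; rewrite ?ltxx ?cx ?cx' //.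
- by move=> /pI[/esym/eqP]; rewrite (negbTE u01).
- by move=> /pI[/eqP]; rewrite (negbTE u01).
- by move=> /pI[_]; exact: eI.
Qed.

(** If [f] were cofinal, every [y] would lie below some [f l]; the pair of [l] and the code of [y]
    inside [f l] would inject [K] into [L]. *)
Lemma succ_bounded (f : L -> K) : exists y, forall l, f l < y.
Proof.
have [u0 _] := regular_bot L_reg.
have [p pI] := diamond_pairing L_reg L_dia.
have [e eI] := succ_code.
apply: contrapT => n; apply: succ_not_le; apply/(card_le_injP u0).
have /boolp.choice[h hP] : forall y, exists l, y <= f l.
  move=> y; apply: contrapT => ny; apply: n; exists y => l.
  by rewrite ltNge; apply/negP => yl; apply: ny; exists l.
exists (fun y => p (h y) (e (f (h y)) y)); split=> // y y' _ _ /pI[e1].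
by rewrite e1 => /eI; apply=> //; rewrite -e1.
Qed.

Lemma succ_initially_bounded : initially_bounded K.
Proof.
have [u0 _] := regular_bot L_reg.
move=> f x; have [e eI] := succ_code.
pose i l := eps x (fun c => c < x /\ e x c = l).
have [y hy] := succ_bounded (f \o i); exists y => c cx.
suff <- : i (e x c) = c by exact: hy.
have [h1 h2] := epsP x (ex_intro (fun c' => c' < x /\ e x c' = e x c) c (conj cx erefl)).
by apply: (eI x) => //; exact: ltW.
Qed.

Lemma succ_countably_bounded : countably_bounded K.
Proof.
have [u0 _] := regular_bot L_reg.
move=> s.
have /(card_le_injP u0)[i [_ iI]] : [set: nat] #<= [set: L].
  apply/infiniteP => /finite_set_countable; by case: L_reg.
have [y hy] := succ_bounded (fun l => s (eps 0%N (fun n => i n = l))); exists y => n.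
have := hy (i n); congr (s _ < _); apply: iI => //.
exact: (epsP 0%N (ex_intro (fun m => i m = i n) n erefl)).
Qed.

End Successor.

(** * Ladders *)

Section Rank.
Context dL (L : orderType dL) dK (K : orderType dK).
Context (L_wo : wo L) (K_wo : wo K) (l0 : L).

Definition rank_step (A : set K) (a : K) (r : K -> L) : L :=
  eps l0 (fun l => (forall b, A b -> b < a -> r b < l) /\
    forall l', (forall b, A b -> b < a -> r b < l') -> l <= l').

(** The order type of [A] below [a], as an element of [L]: the least strict upper bound of the ranks
    of smaller members of [A], or the default [l0] if there is none. *)
Definition rank (A : set K) : K -> L := wrec K_wo l0 (rank_step A).

Lemma rank_step_ext A A' a r r' :
  (forall b, b < a -> (A b <-> A' b) /\ r b = r' b) ->
  rank_step A a r = rank_step A' a r'.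
Proof.
move=> h; rewrite /rank_step; congr eps; apply/funext => l.
have e l' : (forall b, A b -> b < a -> r b < l') = (forall b, A' b -> b < a -> r' b < l').
  apply/propext; split=> hb b Ab ba; have [AA rr] := h _ ba.
    by rewrite -rr; apply: hb; [exact/AA|].
  by rewrite rr; apply: hb; [exact/AA|].
rewrite e; congr (_ /\ _); apply/propext; split=> hl l'; first by rewrite -e; exact: hl.
by rewrite e; exact: hl.
Qed.

Lemma rankE A a : rank A a = rank_step A a (rank A).
Proof. by rewrite /rank wrecE; apply: rank_step_ext => b ->. Qed.

Lemma rank_ext A A' a : (forall b, b < a -> (A b <-> A' b)) -> rank A a = rank A' a.
Proof.
elim/(wo_ind K_wo): a => a IH h; rewrite 2!rankE; apply: rank_step_ext => b ba.
split; first exact: h.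
by apply: IH => // c cb; apply: h; exact: lt_trans ba.
Qed.

Lemma rank_lub A a l : (forall b, A b -> b < a -> rank A b < l) ->
  (forall b, A b -> b < a -> rank A b < rank A a) /\ rank A a <= l.
Proof.
move=> hl; rewrite [rank A a]rankE.
have [m mP mmin] := L_wo (ex_intro (fun l => forall b, A b -> b < a -> rank A b < l) l hl).
have [h1 h2] := epsP l0 (ex_intro (fun l => (forall b, A b -> b < a -> rank A b < l) /\
    forall l', (forall b, A b -> b < a -> rank A b < l') -> l <= l') m (conj mP mmin)).
by split=> //; exact: h2.
Qed.

(** A strictly increasing map into [L] dominates the ranks inductively, so the upper bounds required
    by the recursion exist. *)
Lemma rank_mono A (i : K -> L) : (forall b c, A b -> A c -> b < c -> i b < i c) ->
  forall a, A a -> (forall b, A b -> b < a -> rank A b < rank A a) /\ rank A a <= i a.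
Proof.
move=> imono; elim/(wo_ind K_wo) => a IH Aa; apply: rank_lub => b Ab ba.
exact: le_lt_trans (IH _ ba Ab).2 (imono _ _ Ab Aa ba).
Qed.

End Rank.

(* The boxed diamond controls only [acc (C a)]. For the sealing argument
   consecutive points of the ladder have to lie in the guessed club, so ladders are
   formed by the sets [D a = acc (C a)], or by an unbounded part of [C a] without limit
   points if [acc (C a)] is bounded in [a]. *)
Definition ladder dL (L : orderType dL) dK (K : orderType dK) (D X : K -> set K) :=
  [/\ forall a, limp [set: K] a -> D a `<=` below a /\ limp (D a) a,
      forall a b, limp [set: K] a -> b < a -> limp (D a) b ->
        [/\ D a b, D b = D a `&` below b & X b = X a `&` below b],
      forall a, limp [set: K] a -> exists i : K -> L,
        forall b c, D a b -> D a c -> b < c -> i b < i c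
    & forall Y E : set K, club E -> exists a,
        [/\ limp [set: K] a, D a `<=` E, X a = Y `&` below a
          & forall l : L, ~ exists i : K -> L,
              (forall b c, D a b -> D a c -> b < c -> i b < i c) /\
              forall b, D a b -> i b < l]].

Lemma limp_ext d (K : orderType d) (A A' : set K) a :
  (forall b, b < a -> A b -> A' b) -> limp A a -> limp A' a.
Proof.
move=> h [e la]; split=> // b /la[c [Ac bc ca]]; exists c; split=> //; exact: h.
Qed.

Section Thinning.
Context dL (L : orderType dL) dK (K : orderType dK).
Context (L_reg : regular_uncountable L) (K_succ : is_succ_cardinal L K).
Context (K_box : boxed_diamond L K).

Let L_wo : wo L := regular_wo L_reg.
Let L_cb : countably_bounded L := regular_countably_bounded L_reg.
Let L_ib : initially_bounded L := regular_initially_bounded L_reg.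
Let K_wo : wo K := succ_wo K_succ.

Lemma accP (C : set K) a : acc C a <-> C a /\ limp C a.
Proof. by rewrite /acc /= limit_pointP. Qed.

Lemma ladder_exists : exists D X : K -> set K, ladder L D X.
Proof.
have [l0 _] := regular_bot L_reg.
have [C [X [hC hcoh hguess]]] := K_box.
pose big a := forall b, b < a -> exists c, acc (C a) c /\ b < c.
pose D a := [set d | C a d /\ if pselect (big a) is left _ then acc (C a) d
  else forall c, acc (C a) c -> c < d].
have Clim a : limp [set: K] a -> C a `<=` below a /\ limp (C a) a.
  move=> /limit_pointP; case: (hC a) => -[Ca _] sC _ _ [hs e]; split=> //.
  apply/limit_pointP; split=> //.
  rewrite (_ : C a `&` below a = C a) ?sC; last exact/setIidPl.
  by move: hs; rewrite setTI.
have Cidx a : exists i : K -> L, forall b c, C a b -> C a c -> b < c -> i b < i c.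
  case: (hC a) => _ _ [|[l]] /(same_otpP a l0)[i [g [_ _ h]]] _;
    by exists i => b c Cb Cc /(h _ _ Cb Cc).
have DC a : D a `<=` C a by move=> d [].
have Dbig a : big a -> D a = acc (C a).
  move=> ba; apply/seteqP; split=> d; rewrite /D /=; case: pselect => // _ [] //.
(* A limit point of [D a] below [a] is a limit point of [C a], hence in [acc (C a)]. If [acc (C a)]
   is bounded, [D a] lies entirely above it, so no such limit point exists. *)
have Dcl a b : b < a -> limp (D a) b -> big a /\ acc (C a) b.
  move=> ba lb.
  have Cab : acc (C a) b.
    have lC : limp (C a) b by apply: limp_ext lb => x _ /DC.
    apply/accP; split=> //; case: (hC a) => -[_ h] _ _ _; apply: h => //.
    exact/limit_pointP.
  split=> //; apply: contrapT => nbig.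
  have [[x xb] /(_ x xb)[d [Dd _ db]]] := lb.
  move: Dd; rewrite /D /=; case: pselect => // _ [_ /(_ _ Cab)].
  by rewrite ltNge (ltW db).
exists D, X; split.
- move=> a la; have [Ca lC] := Clim a la; split=> [d /DC/Ca//|].
  split=> [|x xa]; first by case: la.
  have [ba|nb] := pselect (big a).
    rewrite Dbig //; have [c [cc xc]] := ba _ xa; exists c; split=> //.
    by apply: Ca; have /accP[] := cc.
  have [b [ba nba]] : exists b, b < a /\ forall c, acc (C a) c -> c <= b.
    apply: contrapT => n; apply: nb => b ba; apply: contrapT => nc; apply: n.
    exists b; split=> // c Cc; rewrite leNgt; apply/negP => bc; apply: nc; by exists c.
  have [|c [Cc bc ca]] := lC.2 (Order.max b x); first by rewrite gt_max ba.
  move: bc; rewrite gt_max => /andP[bc xc].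
  exists c; split=> //; split=> //; case: pselect => // _ y /nba yb.
  exact: le_lt_trans bc.
- move=> a b la ba lb; have [biga cb] := Dcl _ _ ba lb.
  have [CE XE] := hcoh _ _ cb.
  have accE : acc (C b) = acc (C a) `&` below b.
    rewrite CE; apply/seteqP; split=> c.
      move=> /accP[[Cc cb'] lc]; split=> //; apply/accP; split=> //.
      by apply: limp_ext lc => x _ [].
    move=> [/accP[Cc lc] cb']; apply/accP; split=> //.
    by apply: limp_ext lc => x xc; split=> //; exact: lt_trans cb'.
  have bigb : big b.
    move=> x xb; have [c []] := lb.2 _ xb; rewrite (Dbig _ biga) => Dc xc cb'.
    by exists c; rewrite accE.
  by split=> //; rewrite ?Dbig.
- move=> a la; have [i h] := Cidx a; exists i => b c /DC Cb /DC Cc; exact: h.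
- move=> Y E Ecl; have [a [/limit_pointP la Cotp XE aE]] := hguess Y E Ecl.
  have [Ca lC] := Clim a la.
  have [f [g [fP gP fm']]] := (same_otpP a l0 _ _ _ _).1 Cotp.
  have fm x y : C a x -> C a y -> (x < y) = (f x < f y).
    by move=> Cx Cy; apply/idP/idP => /(fm' _ _ Cx Cy).
  have gC u : C a (g u) by exact: (gP u I).1.
  have fg u : f (g u) = u by exact: (gP u I).2.
  (* A limit index [z] gives an accumulation point: if [m] were the last point of [C a] before
     [g z], the point with index [succ (f m)] would lie strictly between them. *)
  have accg z : (exists u, u < z) -> (forall u, u < z -> succ u < z) -> acc (C a) (g z).
    move=> [u0 u0z] zs; apply/accP; split=> //.
    have Ccl b : b < g z -> limp (C a) b -> C a b.
      move=> bz lb; case: (hC a) => -[_ h] _ _ _; apply: h; last exact/limit_pointP.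
      exact: lt_trans (Ca _ (gC z)).
    have lt_g u v : C a v -> (v < g u) = (f v < u).
      by move=> Cv; rewrite fm // fg.
    case: (closed_cases K_wo Ccl) => // [h|[m [Cm mz mmax]]].
      by have := h _ (gC u0); rewrite leNgt lt_g // fg u0z.
    have fmz : f m < z by rewrite -lt_g.
    have := mmax (g (succ (f m))) (gC _).
    by rewrite lt_g // fg leNgt fm // fg lt_succ // zs // => /(_ isT).
  have accbig v : exists c, acc (C a) c /\ v < f c.
    have [_ /(_ v)[z [vz hz] _]] := fun_closure_club L_wo L_cb L_ib (@succ _ L) v.
    by exists (g z); rewrite fg; split=> //; apply: accg => //; exists v.
  have biga : big a.
    move=> b ba; have [c [Cc bc ca]] := lC.2 _ ba.
    have [e [ee fe]] := accbig (f c); exists e; split=> //; apply: lt_trans bc _.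
    by rewrite fm //; have /accP[] := ee.
  exists a; split=> //.
    by rewrite Dbig.
  (* The indices in [C a] of the points of [D a] are cofinal in [L]. An increasing [i] with values
     below [l] would inject this cofinal set into [below l], against regularity. *)
  move=> l [i [imono il]].
  have [[_ /(_ l)[_ nl]] _ reg] := L_reg; apply: nl.
  have /reg : cofinal (f @` D a).
    move=> v; have [c [cc vc]] := accbig v; exists (f c); last exact: ltW.
    by exists c; rewrite ?Dbig.
  rewrite card_eq_sym card_eq_le => /andP[h _]; apply: card_le_trans h _.
  apply/(card_le_injP l0); exists (fun u => i (g u)).
  have gf c : D a c -> g (f c) = c by move=> /DC/fP[].
  split=> [_ [c Dc <-]|_ _ [c Dc <-] [c' Dc' <-]]; first by rewrite gf //; exact: il.
  rewrite !gf // => e; congr f.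
  by case: (ltgtP c c') => // /imono h; [have := h Dc Dc'|have := h Dc' Dc]; rewrite e ltxx.
Qed.

End Thinning.

Section SuccessorPairing.
Context dL (L : orderType dL) dK (K : orderType dK).
Context (L_reg : regular_uncountable L) (K_succ : is_succ_cardinal L K).
Context (L_dia : diamond L) (D X : K -> set K) (DX : ladder L D X).

Let K_wo : wo K := succ_wo K_succ.
Let K_cb : countably_bounded K := succ_countably_bounded L_reg K_succ L_dia.
Let K_ib : initially_bounded K := succ_initially_bounded L_reg K_succ L_dia.

(** The equality of [2^lambda] with the successor of lambda: guessing [Y] along the club of points
    above [b] shows that every [Y] bounded by [b] is some [X a], and [E] picks such an index. *)
Lemma bounded_set_code : exists E : set K -> K, forall Y Y' b,
  Y `<=` below b -> Y' `<=` below b -> E Y = E Y' -> Y = Y'.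
Proof.
have [a0 _] := succ_bot K_succ.
have ex Y b : Y `<=` below b -> exists a, X a = Y.
  move=> Yb; case: DX => hD _ _ /(_ Y [set a | b < a])[].
    split=> [|c].
      split=> // a _ /limit_pointP[[x xa] /(_ x xa)[c [/= bc _ ca]]]; exact: lt_trans ca.
    by exists (succ (Order.max b c)) => /=;
      apply: le_lt_trans (lt_succ K_wo K_cb _); rewrite le_max lexx ?orbT.
  move=> a [la aE XE _]; exists a; rewrite XE; apply/setIidPl => y /Yb yb.
  have [_ [[x xa] /(_ x xa)[c [/aE bc _ ca]]]] := hD _ la.
  by apply: lt_trans ca; apply: lt_trans bc.
exists (fun Y => eps a0 (fun a => X a = Y)) => Y Y' b /ex hY /ex hY' e.
by rewrite -(epsP a0 hY) -(epsP a0 hY') e.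
Qed.

(** Pairs are coded by two-element subsets of [K], which are bounded and so have codes by
    [bounded_set_code]. *)
Lemma succ_pairing : exists p : K -> L -> K, forall x l x' l',
  p x l = p x' l' -> x = x' /\ l = l'.
Proof.
have [E EI] := bounded_set_code.
have ls := lt_succ K_wo K_cb.
(* The first point missing from [S x b] is [x], and [succ x] belongs to it exactly when [b] holds,
   so both arguments can be recovered. *)
pose S (x : K) (b : bool) : set K := [set y | y < x \/ b /\ y = succ x].
have Sb x b y : x <= y -> S x b `<=` below (succ (succ y)).
  move=> xy z [zx|[_ ->]]; last by rewrite /below /= lt_succ_le // succ_le // (le_lt_trans xy).
  by apply: lt_trans zx _; apply: (le_lt_trans xy); apply: lt_trans (ls _).
have SI x b x' b' : S x b = S x' b' -> x = x' /\ b = b'.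
  wlog xx' : x x' b b' / x <= x'.
    move=> h e; case: (leP x x') => [/h|/ltW/h]; first exact.
    by move=> /(_ b' b (esym e))[-> ->].
  move=> e; move: xx'; rewrite le_eqVlt => /predU1P[xx|xx'].
    split=> //; apply/idP/idP => bb.
      have [|[]//] : S x' b' (succ x) by rewrite -e; right.
      by rewrite -xx ltNge (ltW (ls _)).
    have [|[]//] : S x b (succ x') by rewrite e; right.
    by rewrite xx ltNge (ltW (ls _)).
  have [|[_ /esym/eqP]] : S x b x by rewrite e; left.
    by rewrite ltxx.
  by rewrite gt_eqF.
pose t (x : K) (b : bool) := E (S x b).
have tI x b x' b' : t x b = t x' b' -> x = x' /\ b = b'.
  move=> /EI e; apply: SI; apply: (e (succ (succ (Order.max x x')))); apply: Sb;
  by rewrite le_max lexx ?orbT.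
have [l0 _] := regular_bot L_reg.
have [a0 _] := succ_bot K_succ.
have [i [_ iI]] : exists i : L -> K, (forall l, [set: L] l -> [set: K] (i l)) /\
    forall l l', [set: L] l -> [set: L] l' -> i l = i l' -> l = l'.
  by apply/(card_le_injP a0); case: K_succ => _ [].
(* The boolean marks tell the two members apart, which turns the unordered pair into an ordered
   one. *)
exists (fun x l => E [set t x false; t (i l) true]) => x l x' l'.
have bd (u v u' v' : K) : exists b, [set u; v] `<=` below b /\ [set u'; v'] `<=` below b.
  exists (succ (Order.max (Order.max u v) (Order.max u' v'))).
  by split=> z [->|->]; rewrite /below /= (lt_succ_le K_wo K_cb) !le_max lexx ?orbT.
have [b [b1 b2]] := bd (t x false) (t (i l) true) (t x' false) (t (i l') true).
move=> /(EI _ _ _ b1 b2) e.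
have : [set t x' false; t (i l') true] (t x false) by rewrite -e; left.
have : [set t x' false; t (i l') true] (t (i l) true) by rewrite -e; right.
case=> /tI[e1] // _; case=> /tI[e2] // _.
by split=> //; exact: iI.
Qed.

Lemma pairing_closure_club (p : K -> L -> K) (h : K -> K) lb :
  club [set a | lb < a /\ forall c, c < a -> h c < a /\ forall l, p c l < a].
Proof.
have hb x : exists y, forall c, c <= x ->
    forall z, [set z | z = h c \/ exists l, z = p c l] z -> z < y.
  have /boolp.choice[f fP] : forall c, exists y, forall l, p c l < y.
    by move=> c; exact: (succ_bounded L_reg K_succ L_dia).
  have [y hy] := K_ib (fun c => Order.max (h c) (f c)) (succ x); exists y => c cx z zc.
  have := hy c; rewrite lt_succ_le // gt_max => /(_ cx)/andP[hc fc].
  by case: zc => [->//|[l ->]]; exact: lt_trans (fP _ _) fc.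
have := closure_club K_wo K_cb lb hb; congr club; apply/seteqP; split=> a [la ha]; split=> // c ca.
  by split=> [|l]; apply: (ha c ca); [left|right; exists l].
by move=> z [->|[l ->]]; have [] := ha c ca.
Qed.

End SuccessorPairing.

(** * The trees *)

Section Agree.
Context dK (K : orderType dK).
Implicit Types (a b : K) (s t : K -> bool).

(* A node of level [a] is represented by any total function that extends it. *)
Definition agree a s t := forall b, b < a -> s b = t b.

Definition restr a t : K -> bool := fun b => (b < a) && t b.

Lemma agree_refl a t : agree a t t. Proof. by []. Qed.

Lemma agree_sym a s t : agree a s t -> agree a t s.
Proof. by move=> h b /h. Qed.

Lemma agree_trans a t s u : agree a s t -> agree a t u -> agree a s u.
Proof. by move=> h h' b ba; rewrite h // h'. Qed.

Lemma agree_le a b s t : b <= a -> agree a s t -> agree b s t.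
Proof. by move=> ba h c cb; apply: h; exact: lt_le_trans ba. Qed.

Lemma agree_restr a t : agree a (restr a t) t.
Proof. by move=> b ba; rewrite /restr ba. Qed.

Lemma agree_restr_le a b t : b <= a -> agree b (restr a t) t.
Proof. by move=> ba; apply: (agree_le ba); exact: agree_restr. Qed.

Lemma restr_agree a s t : agree a s t -> restr a s = restr a t.
Proof. by move=> h; apply/funext => b; rewrite /restr; case: ltP => // /h ->. Qed.

Lemma agree_limp (A : set K) a s t : limp A a ->
  (forall c, A c -> c < a -> agree c s t) -> agree a s t.
Proof. by move=> [_ la] h b /la[c [Ac bc ca]]; exact: (h c). Qed.

End Agree.

Arguments agree_restr {dK K} a t.

(** The interface between the construction and the Souslin argument; [T a g t] says that [t] below
    [a] is a node of level [a] of the tree of [g]. The first half describes a single tree. The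
    second concerns products over a bounded [J]: levels have size at most lambda, and every dense
    open [S] contains a whole level. *)
Definition tree_family dL (L : orderType dL) dK (K : orderType dK)
    (T : K -> (K -> bool) -> set (K -> bool)) : Prop :=
  [/\ forall a g s t, agree a s t -> T a g s -> T a g t,
      forall a b g t, b <= a -> T a g t -> T b g t,
      forall a g t, ~ limp [set: K] a -> (forall b, b < a -> T b g t) -> T a g t,
      forall a b g t, b <= a -> T b g t -> exists s, T a g s /\ agree b s t
    & forall a g s t, limp [set: K] a ->
        (forall b, b < a -> T b g s) -> (forall b, b < a -> T b g t) ->
        ~ T a g s -> ~ T a g t -> agree a s t] /\
  forall (J : set L) (jb : L) (gs : L -> K -> bool), (forall j, J j -> j < jb) ->
    (forall a, exists k : (L -> K -> bool) -> L, forall y y',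
      (forall j, J j -> T a (gs j) (y j)) -> (forall j, J j -> T a (gs j) (y' j)) ->
      k y = k y' -> forall j, J j -> agree a (y j) (y' j)) /\
    forall S : K -> (L -> K -> bool) -> Prop,
    (forall j j', J j -> J j' -> gs j = gs j' -> j = j') ->
    (forall d y y', (forall j, J j -> agree d (y j) (y' j)) -> S d y -> S d y') ->
    (forall d e y, d <= e -> S d y -> (forall j, J j -> T e (gs j) (y j)) -> S e y) ->
    (forall d y, (forall j, J j -> T d (gs j) (y j)) -> exists e y',
      [/\ d <= e, S e y', forall j, J j -> T e (gs j) (y' j)
        & forall j, J j -> agree d (y' j) (y j)]) ->
    exists a, forall y, (forall j, J j -> T a (gs j) (y j)) -> S a y.

Section Tree.
Context dL (L : orderType dL) dK (K : orderType dK).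
Context (L_wo : wo L) (K_wo : wo K).
Context (l0 : L) (k0 : K) (G : L -> L -> L -> L) (pi : K -> L -> K) (pr : L -> L -> L).
Context (D X : K -> set K) (DX : ladder L D X).

Definition tree := K -> (K -> bool) -> set (K -> bool).
Implicit Types (T : tree) (a b c d n : K) (g s t : K -> bool) (A B : set K).

(** A name in [L] for a node of level [d]. The recursion needs names before levels are known to be
    small, so injectivity is built into the choice and its possibility is proved later, in
    [Tr_codable]. Truncating [t] makes the name depend on the node only. *)
Definition code d (S : set (K -> bool)) t : L :=
  eps (fun=> l0) (fun k => forall s t, S s -> S t -> k s = k t -> agree d s t) (restr d t).

Definition tag m : L := iter m (@succ _ L) l0.

(* The set [B], an initial segment of some [X a], codes an index set [guess_dom B],
   a family [guess_fun B] of functions on it, and a set of vectors of nodes; the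
   nodes at level [d] of the latter are named by [guess_set B d]. *)
Definition guess_fun B (j : L) : K -> bool := fun d => `[< B (pi d (pr j (tag 0))) >].
Definition guess_dom B (j : L) : Prop := B (pi k0 (pr j (tag 1))).
Definition guess_set B d (l : L) : Prop := B (pi d (pr l (tag 2))).

Local Notation rk := (rank K_wo l0).

Definition matched T A c n B g t j :=
  [/\ guess_dom B j, agree n g (guess_fun B j)
    & forall d, A d -> code d (T d g) t = G (rk A c) j (rk A d)].

(* As the codes of [y j] at the levels in [A] determine it below [sup A], a good
   vector extends the vector guessed by [G (rk A c)] when [c] is a limit point of [A]. *)
Definition good T A c n B (y : L -> K -> bool) :=
  (forall j, guess_dom B j -> T n (guess_fun B j) (y j) /\
    forall d, A d -> code d (T d (guess_fun B j)) (y j) = G (rk A c) j (rk A d)) /\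
  exists d l, [/\ d < n, guess_set B d l
    & forall j, guess_dom B j -> code d (T d (guess_fun B j)) (y j) = G l j l0].

(** The good vector is chosen independently of [g] and [t]; these only select a coordinate. Hence
    all coordinates of a guessed vector move jointly, although each tree computes its walk
    separately. *)
Definition step T A c n B g t : K -> bool :=
  if `[< [/\ limp A c, exists y, good T A c n B y & exists j, matched T A c n B g t j] >]
  then eps (fun _ _ => false) (good T A c n B) (eps l0 (matched T A c n B g t))
  else eps (fun _ => false) (fun y => T n g y /\ agree c y t).

Definition cut n T : tree := fun a => if a <= n then T a else fun=> set0.

Definition next A c := eps c (fun d => [/\ A d, c < d & forall e, A e -> c < e -> d <= e]).

(* All arguments are truncated, so that the value depends on [a] only through
   [D a] and [X a] below [next (D a) c]. *)
Definition walk T a c g t : K -> bool :=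
  let n := next (D a) c in
  step (cut n T) (D a `&` below c) c n (X a `&` below n) (restr n g) (restr c t).

Definition canonical T a g t := exists2 x, D a x &
  forall c, D a c -> x <= c -> agree (next (D a) c) t (walk T a c g t).

Definition short a := exists l, forall d, D a d -> rk (D a) d < l.

Definition removed T a g t :=
  [/\ limp [set: K] a, short a,
      forall d, D a d -> code d (T d g) t = G (rk (D a) a) l0 (rk (D a) d)
    & ~ canonical T a g t].

Definition remaining (R : tree) : tree := fun a g t => forall b, b <= a -> ~ R b g t.

(** The recursion produces the removed branches, and the tree is what survives all removals up to
    its level. Truncating [g] and [t] makes dependence on their values below [a] alone hold by
    construction. *)
Definition rem : tree := wrec K_wo (fun=> set0)
  (fun a R g t => removed (remaining R) a (restr a g) (restr a t)).

Definition Tr : tree := remaining rem.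

(** * Locality and coherence of removals and walks *)

Lemma nextP A c d : A d -> c < d ->
  [/\ A (next A c), c < next A c & forall e, A e -> c < e -> next A c <= e].
Proof.
move=> Ad cd; apply: (epsP c (P := fun d => [/\ A d, c < d & forall e, A e -> c < e -> d <= e])).
have [m [Am cm] mmin] := K_wo (ex_intro (fun d => A d /\ c < d) d (conj Ad cd)).
by exists m; split=> // e Ae ce; exact: mmin.
Qed.

Lemma next_ladder a c : limp [set: K] a -> D a c ->
  [/\ D a (next (D a) c), c < next (D a) c, next (D a) c < a
    & forall e, D a e -> c < e -> next (D a) c <= e].
Proof.
case: DX => hD _ _ _ la Dc; have [Da lD] := hD _ la.
have [e [De ce ea]] := lD.2 _ (Da _ Dc).
by have [Dn cn nmin] := nextP De ce; split=> //; exact: Da.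
Qed.

Lemma ladder_lt a c : limp [set: K] a -> D a c -> c < a.
Proof. by case: DX => hD _ _ _ la Dc; have [Da _] := hD _ la; exact: Da. Qed.

Lemma ladder_limp a : limp [set: K] a -> limp (D a) a.
Proof. by case: DX => hD _ _ _ la; have [] := hD _ la. Qed.

Lemma limp_limit A a : limp A a -> limp [set: K] a.
Proof. exact: limp_ext. Qed.

Lemma cut_eq n T T' : (forall a, a <= n -> T a = T' a) -> cut n T = cut n T'.
Proof. by move=> h; apply/funext => a; rewrite /cut; case: leP => // /h. Qed.

(** Points of [D a] lie below [a] and each walk is cut at [next (D a) c < a], so only levels below
    [a] are consulted. This lets the recursion unfold to [Tr] itself. *)
Lemma removed_local T T' a g t : (forall b, b < a -> T b = T' b) ->
  removed T a g t -> removed T' a g t.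
Proof.
move=> h [la sa cd nc]; split=> // [d Dd|]; first by rewrite -h ?cd //; exact: ladder_lt.
move=> [x Dx cx]; apply: nc; exists x => // c Dc xc; move: (cx _ Dc xc).
rewrite /walk (@cut_eq _ T T') // => b bn; apply: h; apply: le_lt_trans bn _.
by have [] := next_ladder la Dc.
Qed.

Lemma rem_restr a g t : rem a g t <-> removed Tr a (restr a g) (restr a t).
Proof.
rewrite /rem wrecE -/rem.
have e b : b < a -> remaining (fun b => if b < a then rem b else fun=> set0) b = Tr b.
  move=> ba; apply/funext => g'; apply/funext => t'; apply/propext.
  by split=> h c cb; have := h c cb; rewrite (le_lt_trans cb ba).
by split; apply: removed_local => b /e.
Qed.

Lemma rem_agree a g g' t t' : agree a g g' -> agree a t t' -> rem a g t -> rem a g' t'.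
Proof.
move=> hg ht /rem_restr h; apply/rem_restr.
by rewrite -(restr_agree hg) -(restr_agree ht).
Qed.

Lemma Tr_agree a g g' t t' : agree a g g' -> agree a t t' -> Tr a g t -> Tr a g' t'.
Proof.
move=> hg ht h b ba r; apply: (h b ba); apply: rem_agree r; apply: agree_sym;
exact: agree_le ba _.
Qed.

Lemma Tr_node a g t t' : agree a t t' -> Tr a g t -> Tr a g t'.
Proof. exact: Tr_agree. Qed.

Lemma Tr_local a g g' : agree a g g' -> Tr a g = Tr a g'.
Proof.
move=> h; apply/seteqP; split=> t; first exact: Tr_agree.
by apply: Tr_agree => //; exact: agree_sym.
Qed.

Lemma Tr_le a b g t : b <= a -> Tr a g t -> Tr b g t.
Proof. by move=> ba h c cb; apply: h; exact: le_trans ba. Qed.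

Lemma code_agree d (S : set (K -> bool)) s t : agree d s t -> code d S s = code d S t.
Proof. by move=> h; rewrite /code (restr_agree h). Qed.

Lemma walk_agree T a c g s t : agree c s t -> walk T a c g s = walk T a c g t.
Proof. by move=> h; rewrite /walk (restr_agree h). Qed.

Lemma restr_restr a b t : b <= a -> restr b (restr a t) = restr b t.
Proof. by move=> ba; apply: restr_agree; exact: agree_restr_le. Qed.

Lemma remP a g t : rem a g t <-> removed Tr a g t.
Proof.
have walkE c : limp [set: K] a -> D a c ->
    walk Tr a c (restr a g) (restr a t) = walk Tr a c g t.
  move=> la Dc; have [_ cn na _] := next_ladder la Dc.
  by rewrite /walk !restr_restr // ltW // (lt_trans cn).
split=> [/rem_restr|] [la sa cd nc]; last apply/rem_restr.
- split=> // [d Dd|[x Dx cx]].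
    have da := ltW (ladder_lt la Dd); rewrite -cd //.
    rewrite (Tr_local (agree_restr_le _ da)); apply: code_agree.
    by apply: agree_sym; exact: agree_restr_le.
  apply: nc; exists x => // c Dc xc; rewrite walkE //; apply: agree_trans (cx _ Dc xc).
  by apply: agree_restr_le; apply: ltW; have [] := next_ladder la Dc.
- split=> // [d Dd|[x Dx cx]].
    have da := ltW (ladder_lt la Dd); rewrite -cd //.
    by rewrite (Tr_local (agree_restr_le _ da)); apply: code_agree; exact: agree_restr_le.
  apply: nc; exists x => // c Dc xc; rewrite -walkE //.
  apply: agree_trans (cx _ Dc xc); apply: agree_sym.
  by apply: agree_restr_le; apply: ltW; have [] := next_ladder la Dc.
Qed.

(** A walk step reads [D a] below [c] and [X a] below the next point only, and there the ladders at
    [a] and at its limit point [b] coincide. *)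
Lemma ladder_coherence a b c : limp [set: K] a -> b < a -> limp (D a) b ->
  D a c -> c < b ->
  [/\ D b c, next (D b) c = next (D a) c, next (D a) c < b
    & walk Tr b c = walk Tr a c].
Proof.
case: DX => _ hcoh _ _ la ba lb Dc cb.
have [Dab DbE XbE] := hcoh _ _ la ba lb.
have [e [De ce eb]] := lb.2 _ cb.
have Dbc : D b c by rewrite DbE.
have Dbe : D b e by rewrite DbE.
have [n1 n2 n3] := nextP De ce; have [m1 m2 m3] := nextP Dbe ce.
have nb : next (D a) c < b by exact: le_lt_trans (n3 _ De ce) eb.
have ne : next (D b) c = next (D a) c.
  apply/eqP; rewrite eq_le m3 //= ?n3 //; last by rewrite DbE.
  by move: m1; rewrite DbE => -[].
split=> //; apply/funext => g; apply/funext => t; rewrite /walk ne.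
congr step.
- rewrite DbE -setIA; congr setI; apply/setIidPr => x /= xc; exact: lt_trans cb.
- rewrite XbE -setIA; congr setI; apply/setIidPr => x /= xc; exact: lt_trans nb.
Qed.

Lemma ladder_cases a b : limp [set: K] a -> D a b \/ b = a ->
  [\/ limp (D a) b, forall d, D a d -> b <= d |
      exists m, [/\ D a m, m < b, b = next (D a) m & D a b]].
Proof.
move=> la hb.
have ba : b <= a by case: hb => [/(ladder_lt la)/ltW//|->].
have cl c : c < b -> limp (D a) c -> D a c.
  by case: DX => _ hcoh _ _ cb lc; have [] := hcoh _ _ la (lt_le_trans cb ba) lc.
case: (closed_cases K_wo cl) => [h|h|[m [Dm mb mmax]]]; [by constructor 1|by constructor 2|].
have [n1 n2 n3 n4] := next_ladder la Dm.
case: hb => [Db|e].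
  constructor 3; exists m; split=> //; apply/eqP; rewrite eq_le n4 // andbT leNgt.
  by apply/negP => nb; have := mmax _ n1 nb; rewrite leNgt n2.
by have := mmax _ n1; rewrite e n3 leNgt n2 => /(_ isT).
Qed.

(** Induction along the ladder: a walk step reads the function only below its starting point, and at
    limit points nothing new is decided. So a canonical branch is determined by a starting point and
    its node there. *)
Lemma walk_uniq a x b g s t : limp [set: K] a -> D a x -> D a b \/ b = a ->
  agree x s t ->
  (forall c, D a c -> x <= c -> next (D a) c <= b -> agree (next (D a) c) s (walk Tr a c g s)) ->
  (forall c, D a c -> x <= c -> next (D a) c <= b -> agree (next (D a) c) t (walk Tr a c g t)) ->
  agree b s t.
Proof.
move=> la Dx; elim/(wo_ind K_wo): b => b IH hb est hs ht.
have [bx|xb] := leP b x; first exact: agree_le est.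
have IH' c : c < b -> D a c -> agree c s t.
  move=> cb Dc; apply: IH => // [|e De xe ec|e De xe ec]; first by left.
    by apply: hs => //; exact: le_trans (ltW cb).
  by apply: ht => //; exact: le_trans (ltW cb).
case: (ladder_cases la hb) => [lb|h|[m [Dm mb bE _]]].
- by apply: (agree_limp lb) => c Dc cb; exact: IH'.
- by have := h _ Dx; rewrite leNgt xb.
- have xm : x <= m.
    rewrite leNgt; apply/negP => mx; have [_ _ _ h] := next_ladder la Dm.
    by have := h _ Dx mx; rewrite -bE leNgt xb.
  have es := hs _ Dm xm; have et := ht _ Dm xm; rewrite -bE in es et.
  apply: agree_trans (es (lexx _)) _; rewrite (walk_agree _ _ _ (IH' _ mb Dm)).
  by apply: agree_sym; exact: et.
Qed.

Context (L_cb : countably_bounded L) (K_cb : countably_bounded K).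
Context (prI : forall j u j' u', pr j u = pr j' u' -> j = j' /\ u = u').
Context (GP : forall (F : L -> L -> L) h lb, exists z,
  [/\ lb < z, forall u, u < z -> h u < z
    & forall j u, j < z -> u < z -> G z j u = F j u]).

Lemma rk_mono a b c : limp [set: K] a -> D a b -> D a c -> b < c ->
  rk (D a) b < rk (D a) c.
Proof.
case: DX => _ _ hidx _ la Db Dc bc; have [i im] := hidx _ la.
by have [h _] := rank_mono L_wo K_wo l0 im Dc; exact: h.
Qed.

Lemma rk_lt a b c : limp [set: K] a -> D a b -> D a c ->
  rk (D a) b < rk (D a) c -> b < c.
Proof.
move=> la Db Dc; case: (ltgtP b c) => // [cb|->]; last by rewrite ltxx.
by rewrite ltNge (ltW (rk_mono la Dc Db cb)).
Qed.

Lemma rk_inj a b c : limp [set: K] a -> D a b -> D a c ->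
  rk (D a) b = rk (D a) c -> b = c.
Proof.
move=> la Db Dc e; case: (ltgtP b c) => // [bc|cb].
  by have := rk_mono la Db Dc bc; rewrite e ltxx.
by have := rk_mono la Dc Db cb; rewrite e ltxx.
Qed.

Lemma rk_least A c l : (forall b, A b -> b < c -> rk A b < l) -> rk A c <= l.
Proof. by move=> /(rank_lub L_wo)[]. Qed.

(** The least point of rank at least [l] has rank exactly [l], since ranks are least strict upper
    bounds. *)
Lemma rk_onto a l : limp [set: K] a -> ~ short a -> exists2 d, D a d & rk (D a) d = l.
Proof.
move=> la nsa; have [d0 [Dd0 ld0]] : exists d, D a d /\ l <= rk (D a) d.
  apply: contrapT => n; apply: nsa; exists l => d Dd.
  by rewrite ltNge; apply/negP => ld; apply: n; exists d.
have [d [Dd ld] dmin] := K_wo (ex_intro (fun d => D a d /\ l <= rk (D a) d) d0 (conj Dd0 ld0)).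
exists d => //; apply/eqP; rewrite eq_le ld andbT; apply: rk_least => b Db bd.
by rewrite ltNge; apply/negP => lb; have := dmin b (conj Db lb); rewrite leNgt bd.
Qed.

(** The first point of the ladder has rank at most [l0], and a point with immediate predecessor [m]
    has rank at most any [v] above the rank of [m]. *)
Lemma limp_of_rk a c : limp [set: K] a -> D a c -> l0 < rk (D a) c ->
  (forall u, u < rk (D a) c -> exists2 v, u < v & v < rk (D a) c) -> limp (D a) c.
Proof.
move=> la Dc l0c hc; case: (ladder_cases la (or_introl Dc)) => // [h|[m [Dm mc cE _]]].
  have : rk (D a) c <= l0 by apply: rk_least => b /h; rewrite leNgt => /negbTE ->.
  by rewrite leNgt l0c.
have [v mv vc] := hc _ (rk_mono la Dm Dc mc).
have : rk (D a) c <= v.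
  apply: rk_least => b Db bc; apply: le_lt_trans mv.
  rewrite leNgt; apply/negP => /(rk_lt la Dm Db) mb.
  by have [_ _ _ /(_ _ Db mb)] := next_ladder la Dm; rewrite -cE leNgt bc.
by rewrite leNgt vc.
Qed.

Lemma rk_coherence a b d : limp [set: K] a -> b < a -> limp (D a) b ->
  d <= b -> rk (D b) d = rk (D a) d.
Proof.
case: DX => _ hcoh _ _ la ba lb db; have [_ -> _] := hcoh _ _ la ba lb.
by apply: rank_ext => c cd; split=> [[]//|Dc]; split=> //; exact: lt_le_trans db.
Qed.

(* If the walks failed to follow [t] cofinally often, then at some limit point [b]
   of [D a] below which they fail cofinally, the diamond would have guessed [t],
   so that [t] would have been removed at level [b]. *)
Lemma canonical_of_long a g t : limp [set: K] a -> ~ short a ->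
  (forall b, b < a -> Tr b g t) -> canonical Tr a g t.
Proof.
move=> la nsa tT; apply: contrapT => nc.
pose bad u c := [/\ D a c, u <= rk (D a) c & ~ agree (next (D a) c) t (walk Tr a c g t)].
have /boolp.choice[f fP] u : exists c, bad u c.
  have [x Dx xu] := rk_onto u la nsa.
  apply: contrapT => n; apply: nc; exists x => // c Dc xc; apply: contrapT => nac.
  apply: n; exists c; split=> //; move: xc; rewrite -xu le_eqVlt => /predU1P[->//|xc].
  by rewrite ltW // rk_mono.
have /boolp.choice[dd ddP] u : exists d, D a d /\ rk (D a) d = u.
  by have [d Dd e] := rk_onto u la nsa; exists d.
pose h u := rk (D a) (next (D a) (f u)).
have uh u : u < h u.
  have [Df uf _] := fP u; have [Dn fn _ _] := next_ladder la Df.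
  by apply: le_lt_trans uf _; exact: rk_mono.
(* Here [f u] is a failure of rank at least [u] and [h u] is the rank of the ladder point after it.
   As [z] is closed under [h], the point [b] of rank [z] is a limit point of [D a] and failures are
   cofinal below it. *)
have [z [l0z hz Gz]] := GP (fun _ u => code (dd u) (Tr (dd u) g) t) h l0.
have [Db rb] := ddP z; set b := dd z in Db rb.
have ba := ladder_lt la Db.
have lb : limp (D a) b.
  by apply: limp_of_rk => //; rewrite rb // => u uz; exists (h u); [exact: uh|exact: hz].
have DbE : D b = D a `&` below b by case: DX => _ hcoh _ _; have [] := hcoh _ _ la ba lb.
apply: (tT b ba b (lexx b)); apply/remP; split; first exact: limp_limit lb.
- exists z => d; rewrite {1}DbE => -[Dd db]; rewrite (rk_coherence la ba lb (ltW db)) -rb.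
  exact: rk_mono.
- move=> d; rewrite {1}DbE => -[Dd db].
  rewrite (rk_coherence la ba lb (lexx b)) (rk_coherence la ba lb (ltW db)) rb.
  have dz : rk (D a) d < z by rewrite -rb rk_mono.
  rewrite Gz //; have [De e] := ddP (rk (D a) d).
  by rewrite (rk_inj la De Dd e).
(* If [t] were canonical at [b] from [x] on, it would follow the walk at the failure chosen for the
   rank of [x], which lies between [x] and [b]. *)
- move=> [x]; rewrite {1}DbE => -[Dx xb] cx.
  have [Df xf nf] := fP (rk (D a) x); set c := f _ in Df xf nf.
  have xz : rk (D a) x < z by rewrite -rb rk_mono.
  have cz : rk (D a) c < z.
    apply: lt_trans (hz _ xz); have [Dn cn _ _] := next_ladder la Df; exact: rk_mono.
  have cb : c < b by apply: (rk_lt la Df Db); rewrite rb.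
  have [Dbc ne _ we] := ladder_coherence la ba lb Df cb.
  apply: nf; rewrite -we -ne; apply: (cx _ Dbc).
  by rewrite leNgt; apply/negP => /(rk_mono la Df Dx); rewrite ltNge xf.
Qed.

(** * Small levels, extendibility and fullness *)

Definition codable d g := exists k : (K -> bool) -> L,
  forall s t, Tr d g s -> Tr d g t -> k s = k t -> agree d s t.

Lemma code_inj d g s t : codable d g -> Tr d g s -> Tr d g t ->
  code d (Tr d g) s = code d (Tr d g) t -> agree d s t.
Proof.
move=> cd Ts Tt e.
have rT u : Tr d g u -> Tr d g (restr d u).
  by apply: Tr_node; exact: agree_sym (agree_restr _ _).
have h := epsP (fun=> l0) cd _ _ (rT _ Ts) (rT _ Tt) e.
apply: agree_trans (agree_sym (agree_restr _ _)) (agree_trans h (agree_restr _ _)).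
Qed.

Lemma tag_inj m m' : tag m = tag m' -> m = m'.
Proof.
have h (m1 m2 : nat) : (m1 < m2)%N -> tag m1 < tag m2.
  elim: m2 => // m2 IH; rewrite ltnS leq_eqVlt => /predU1P[->|/IH]; first exact: lt_succ.
  by move=> /lt_trans; apply; exact: lt_succ.
by move=> e; case: (ltngtP m m') => // /h; rewrite e ltxx.
Qed.

(** At a successor, one bit is added to the code below. Over a short ladder, the codes along [D a]
    form a sequence of length less than lambda, which diamond names by one index. Over a long ladder
    every branch is canonical, hence given by a starting point and its node there. *)
Lemma Tr_codable a g : codable a g.
Proof.
elim/(wo_ind K_wo): a => a IH.
case: (ord_cases K_wo K_cb a) => [amin|[b ab]|la].
- by exists (fun=> l0) => s t _ _ _ b; rewrite ltNge amin.
- have ba : b < a by rewrite ab lt_succ.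
  have [k kP] := IH _ ba.
  exists (fun t => pr (k t) (tag (t b))) => s t Ts Tt /prI[ek /tag_inj eb] c.
  rewrite ab lt_succ_le // le_eqVlt => /predU1P[->|cb]; first by case: (s b) (t b) eb => -[].
  by apply: kP ek _ cb; [apply: Tr_le Ts|apply: Tr_le Tt]; exact: ltW.
have below_codes d s t : Tr a g s -> Tr a g t -> D a d ->
    code d (Tr d g) s = code d (Tr d g) t -> agree d s t.
  move=> Ts Tt Dd; have da := ladder_lt la Dd.
  by apply: code_inj; [exact: IH|apply: Tr_le Ts|apply: Tr_le Tt]; exact: ltW.
have [[l lP]|nsa] := pselect (short a).
- pose dd u := eps k0 (fun d => D a d /\ rk (D a) d = u).
  have ddE d : D a d -> dd (rk (D a) d) = d.
    move=> Dd; have [De e] := epsP k0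
      (ex_intro (fun e => D a e /\ rk (D a) e = rk (D a) d) d (conj Dd erefl)).
    exact: rk_inj la De Dd e.
  pose F t u := code (dd u) (Tr (dd u) g) t.
  have exl t : exists z, forall u, u < l -> G z l0 u = F t u.
    have [z [lz _ Gz]] := GP (fun=> F t) id (Order.max l l0).
    move: lz; rewrite gt_max => /andP[lz l0z].
    by exists z => u ul; apply: Gz => //; exact: lt_trans lz.
  exists (fun t => eps l0 (fun z => forall u, u < l -> G z l0 u = F t u)) => s t Ts Tt e.
  apply: (agree_limp (ladder_limp la)) => d Dd da; apply: below_codes => //.
  have h1 := epsP l0 (exl s) _ (lP d Dd); have h2 := epsP l0 (exl t) _ (lP d Dd).
  by move: h2; rewrite -e h1 /F ddE.
- have can t : Tr a g t -> exists x, D a x /\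
      forall c, D a c -> x <= c -> agree (next (D a) c) t (walk Tr a c g t).
    move=> Tt; have [|x Dx cx] := @canonical_of_long a g t la nsa.
      by move=> b ba; apply: Tr_le Tt; exact: ltW.
    by exists x.
  pose st t := eps k0 (fun x => D a x /\
      forall c, D a c -> x <= c -> agree (next (D a) c) t (walk Tr a c g t)).
  exists (fun t => pr (rk (D a) (st t)) (code (st t) (Tr (st t) g) t)) => s t Ts Tt.
  have [Dxs cs] := epsP k0 (can _ Ts); have [Dxt ct] := epsP k0 (can _ Tt).
  rewrite -/(st s) -/(st t) in Dxs cs Dxt ct *.
  move=> /prI[/(rk_inj la Dxs Dxt) e]; rewrite -e in ct * => /(below_codes _ _ _ Ts Tt Dxs) st_.
  by apply: (walk_uniq la Dxs _ st_) => [|c Dc xc _|c Dc xc _]; [right|exact: cs|exact: ct].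
Qed.

Lemma Tr_code_inj d g s t : Tr d g s -> Tr d g t ->
  code d (Tr d g) s = code d (Tr d g) t -> agree d s t.
Proof. exact/code_inj/Tr_codable. Qed.

Definition extendible a := forall b g t, b <= a -> Tr b g t ->
  exists s, Tr a g s /\ agree b s t.

(** At every [d] of the ladder below [c], both [y j] and [t] have the guessed code, so they agree up
    to [d]; these [d] are cofinal in the limit point [c]. *)
Lemma matched_agree a c g t j y : limp [set: K] a -> D a c -> Tr c g t ->
  let n := next (D a) c in
  limp (D a `&` below c) c ->
  matched (cut n Tr) (D a `&` below c) c n (X a `&` below n) (restr n g) (restr c t) j ->
  good (cut n Tr) (D a `&` below c) c n (X a `&` below n) y ->
  Tr n g (y j) /\ agree c (y j) t.
Proof.
move=> la Dc Tt n lc [Jj gj mj] [/(_ j Jj)[Ty cy] _].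
have [Dn cn na _] := next_ladder la Dc; rewrite -/n in Dn cn na.
have gj' : agree n (guess_fun (X a `&` below n) j) g.
  by apply: agree_sym; apply: agree_trans gj; apply: agree_sym; exact: agree_restr.
have {}Ty : Tr n g (y j) by move: Ty; rewrite /cut lexx (Tr_local gj').
split=> //; apply: (agree_limp lc) => d Ad dc.
have dn := ltW (lt_trans dc cn).
apply: (@Tr_code_inj d g); [exact: Tr_le Ty|exact: Tr_le (ltW dc) Tt|].
have := mj _ Ad; rewrite -cy // /cut dn (Tr_local (agree_le dn gj')).
rewrite (Tr_local (agree_restr_le g dn)) => <-.
by apply: code_agree; apply: agree_restr_le; exact: ltW.
Qed.

Lemma walk_extends a c g t : limp [set: K] a -> D a c ->
  extendible (next (D a) c) -> Tr c g t ->
  Tr (next (D a) c) g (walk Tr a c g t) /\ agree c (walk Tr a c g t) t.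
Proof.
move=> la Dc ext Tt; rewrite /walk; set n := next (D a) c.
have [Dn cn na _] := next_ladder la Dc; rewrite -/n in Dn cn na.
rewrite /step; case: asboolP => [[lc hy hj]|_].
  exact: (matched_agree la Dc Tt lc (epsP l0 hj) (epsP (fun _ _ => false) hy)).
have [s [Ts st]] := ext _ _ _ (ltW cn) Tt.
have [|h1 h2] := epsP (fun=> false)
  (P := fun y => cut n Tr n (restr n g) y /\ agree c y (restr c t)).
  exists s; split; last by apply: agree_trans st _; exact: agree_sym (agree_restr _ _).
  by rewrite /cut lexx (Tr_local (agree_restr n g)).
split; last by apply: agree_trans h2 _; exact: agree_restr.
by move: h1; rewrite /cut lexx (Tr_local (agree_restr n g)).
Qed.

Lemma Tr_not_limp a g t : ~ limp [set: K] a -> (forall b, b < a -> Tr b g t) -> Tr a g t.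
Proof.
move=> nla h b; rewrite le_eqVlt => /predU1P[->|ba]; first by move/remP => -[].
exact: h ba b (lexx b).
Qed.

(** At a limit level, [t] is first extended to a ladder point [x] above [b] by induction and then
    continued by the walk. The result is canonical at [a] and at all limit points of [D a] beyond
    [x], so it is never removed there. *)
Lemma Tr_extendible a : extendible a.
Proof.
elim/(wo_ind K_wo): a => a IH b g t.
rewrite le_eqVlt => /predU1P[->|ba] Tt; first by exists t.
case: (ord_cases K_wo K_cb a) => [amin|[a' aE]|la].
- by move: ba; rewrite ltNge amin.
- have a'a : a' < a by rewrite aE lt_succ.
  have ba' : b <= a' by rewrite -(lt_succ_le K_wo K_cb) -aE.
  have [s [Ts st]] := IH _ a'a _ _ _ ba' Tt.
  exists s; split=> //; apply: Tr_not_limp; first by rewrite aE; exact: succ_not_limp.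
  by move=> e; rewrite aE lt_succ_le // => ea; exact: Tr_le Ts.
have [x [Dx bx xa]] := (ladder_limp la).2 _ ba.
have [t' [Tt' tt']] := IH _ xa _ _ _ (ltW bx) Tt.
pose W c s := [/\ Tr c g s, agree x s t' & forall e, D a e -> x <= e ->
  next (D a) e <= c -> agree (next (D a) e) s (walk Tr a e g s)].
have W_uniq c e s s' : D a c -> c <= e -> W c s -> W e s' -> agree c s s'.
  move=> Dc ce [_ xs ws] [_ xs' ws'].
  apply: (walk_uniq la Dx (or_introl Dc)); first exact: agree_trans xs (agree_sym xs').
    exact: ws.
  by move=> d Dd xd nc; apply: ws' => //; exact: le_trans ce.
(* At a limit point of the ladder, or at [a], the partial walks cohere by [W_uniq]; their union
   follows the walk from [x] on, hence is canonical and survives at level [c]. *)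
have glue c : c < a \/ c = a -> limp (D a) c -> x < c ->
    (forall d, D a d -> x <= d -> d < c -> exists s, W d s) -> exists s, W c s.
  move=> ca lc xc hW.
  have nextc e : D a e -> e < c -> next (D a) e < c.
    move=> De ec; have [d [Dd ed dc]] := lc.2 _ ec.
    by have [_ _ h] := nextP Dd ed; apply: le_lt_trans dc; exact: h.
  have DcE e : D c e -> D a e /\ e < c.
    case: ca => [ca|ce]; last by rewrite ce => De; split=> //; exact: ladder_lt.
    by case: DX => _ hcoh _ _; have [_ -> _] := hcoh _ _ la ca lc.
  have /boolp.choice[S SP] d : exists s, D a d -> x <= d -> d < c -> W d s.
    have [h|n] := pselect [/\ D a d, x <= d & d < c].
      by have [Dd xd dc] := h; have [s Ws] := hW d Dd xd dc; exists s.
    by exists t => Dd xd dc; exfalso; apply: n.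
  have /boolp.choice[p pP] e : exists d, e < c -> [/\ D a d, x <= d, e < d & d < c].
    have [ec|_] := ltP e c; last by exists e.
    have [|d [Dd ed dc]] := lc.2 (Order.max e x); first by rewrite gt_max ec.
    by move: ed; rewrite gt_max => /andP[ed xd]; exists d => _; rewrite ltW.
  (* The union of the partial walks: the value at [e] is read from the one at some ladder point
     [p e] above [e]. *)
  pose s e := S (p e) e.
  have sS d : D a d -> x <= d -> d < c -> agree d s (S d).
    move=> Dd xd dc e ed; have [Dp xp ep pc] := pP _ (lt_trans ed dc); rewrite /s.
    have [pd|dp] := leP (p e) d.
      exact: (W_uniq _ _ _ _ Dp pd (SP _ Dp xp pc) (SP _ Dd xd dc)).
    exact/esym/(W_uniq _ _ _ _ Dd (ltW dp) (SP _ Dd xd dc) (SP _ Dp xp pc)).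
  have Ws d : D a d -> x <= d -> d < c -> Tr d g s.
    move=> Dd xd dc; have [Ts _ _] := SP _ Dd xd dc.
    exact: Tr_node (agree_sym (sS _ Dd xd dc)) Ts.
  have ws e : D a e -> x <= e -> e < c -> agree (next (D a) e) s (walk Tr a e g s).
    move=> De xe ec; have [Dn en na _] := next_ladder la De.
    have nc := nextc _ De ec; have xn := le_trans xe (ltW en).
    have [_ _ /(_ e De xe (lexx _)) h] := SP _ Dn xn nc.
    apply: agree_trans (sS _ Dn xn nc) (agree_trans h _).
    by rewrite (walk_agree _ _ _ (agree_le (ltW en) (sS _ Dn xn nc))).
  have sx : agree x s t'.
    by apply: agree_trans (sS _ Dx (lexx _) xc) _; have [_ ? _] := SP _ Dx (lexx _) xc.
  exists s; split=> //.
    move=> e; rewrite le_eqVlt => /predU1P[->|ec]; last first.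
      by have [Dp xp ep pc] := pP _ ec; exact: (Ws _ Dp xp pc e (ltW ep)).
    move=> /remP[_ _ _]; apply; case: ca => [ca|ce].
      have [Dcx _ _ _] := ladder_coherence la ca lc Dx xc.
      exists x => // e' /DcE[De ec] xe.
      by have [_ -> _ ->] := ladder_coherence la ca lc De ec; exact: ws.
    by rewrite ce; exists x => // e' De xe; apply: ws => //; rewrite ce; exact: ladder_lt.
  move=> e De xe nc; apply: ws => //; apply: lt_le_trans nc.
  by have [] := next_ladder la De.
have allW c : D a c -> x <= c -> exists s, W c s.
  elim/(wo_ind K_wo): c => c IHc Dc; rewrite le_eqVlt => /predU1P[<-|xc].
    exists t'; split=> // e De xe; rewrite leNgt (le_lt_trans xe) //.
    by have [] := next_ladder la De.
  case: (ladder_cases la (or_introl Dc)) => [lc|h|[m [Dm mc cE _]]].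
  - apply: glue => // [|d Dd xd dc]; first by left; exact: ladder_lt.
    exact: IHc.
  - by have := h _ Dx; rewrite leNgt xc.
  - have nle d : D a d -> d < c -> d <= m.
      move=> Dd dc; rewrite leNgt; apply/negP => md.
      by have [_ _ _ /(_ _ Dd md)] := next_ladder la Dm; rewrite -cE leNgt dc.
    have xm := nle _ Dx xc.
    have [s [Ts xs ws]] := IHc _ mc Dm xm.
    have [] := @walk_extends a m g s la Dm _ Ts; first by rewrite -cE; apply: IH; exact: ladder_lt.
    rewrite -cE => Tw ww; set s' := walk Tr a m g s in Tw ww.
    exists s'; split=> //; first exact: agree_trans (agree_le xm ww) xs.
    move=> e De xe nc; have [Dn en _ nmin] := next_ladder la De.
    have em : e <= m by apply: nle => //; exact: lt_le_trans nc.
    have es : agree e s' s by exact: agree_le ww.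
    rewrite (walk_agree _ _ _ es).
    move: em; rewrite le_eqVlt => /predU1P[->|em]; first exact: agree_refl.
    by apply: agree_trans (agree_le _ ww) (ws _ De xe _); exact: nmin.
have [s [Ts xs _]] : exists s, W a s.
  apply: glue => // [||d Dd xd _]; [by right|exact: ladder_limp|exact: allW].
by exists s; split=> //; apply: agree_trans (agree_le (ltW bx) xs) _.
Qed.

(** A branch missing at level [a] has the guessed codes along [D a]. Two missing branches therefore
    share all their codes, and codes are injective. *)
Lemma Tr_full a g s t : limp [set: K] a ->
  (forall b, b < a -> Tr b g s) -> (forall b, b < a -> Tr b g t) ->
  ~ Tr a g s -> ~ Tr a g t -> agree a s t.
Proof.
move=> la hs ht ns nt.
have rem_of u : (forall b, b < a -> Tr b g u) -> ~ Tr a g u -> removed Tr a g u.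
  move=> hu nu; apply/remP; apply: contrapT => n; apply: nu => b.
  by rewrite le_eqVlt => /predU1P[->//|ba]; exact: hu ba b (lexx b).
have [_ _ cs _] := rem_of _ hs ns; have [_ _ ct _] := rem_of _ ht nt.
apply: (agree_limp (ladder_limp la)) => d Dd da.
by apply: Tr_code_inj; [exact: hs|exact: ht|rewrite cs // ct].
Qed.

Context (L_ib : initially_bounded L).
Context (K_Lb : forall f : L -> K, exists y, forall l, f l < y).
Context (piI : forall a l a' l', pi a l = pi a' l' -> a = a' /\ l = l').
Context (pi_club : forall (h : K -> K) lb,
  club [set a | lb < a /\ forall c, c < a -> h c < a /\ forall l, pi c l < a]).

(** * Sealing dense sets *)

Section Sealing.
Context (J : set L) (jb : L) (gs : L -> K -> bool) (S : K -> (L -> K -> bool) -> Prop).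
Implicit Types y : L -> K -> bool.

Definition vector d y := forall j, J j -> Tr d (gs j) (y j).

Context (J_lt : forall j, J j -> j < jb).
Context (gs_inj : forall j j', J j -> J j' -> gs j = gs j' -> j = j').
Context (S_agree : forall d y y', (forall j, J j -> agree d (y j) (y' j)) -> S d y -> S d y').
Context (S_up : forall d e y, d <= e -> S d y -> vector e y -> S e y).
Context (S_dense : forall d y, vector d y -> exists e y',
  [/\ d <= e, S e y', vector e y' & forall j, J j -> agree d (y' j) (y j)]).

Definition names d l y := forall j, J j -> code d (Tr d (gs j)) (y j) = G l j l0.

(** Since [J] is bounded by [jb], a diamond guess above [jb] names the whole vector by a single
    element of [L]. *)
Lemma names_exists d y : exists l, names d l y.
Proof.
have [z [lz _ Gz]] := GP (fun j _ => code d (Tr d (gs j)) (y j)) id (Order.max jb l0).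
move: lz; rewrite gt_max => /andP[jz l0z].
by exists z => j Jj; rewrite Gz //; exact: lt_trans (J_lt Jj) jz.
Qed.

Lemma names_agree d l y y' j : vector d y -> vector d y' -> names d l y -> names d l y' ->
  J j -> agree d (y j) (y' j).
Proof.
move=> Ty Ty' ny ny' Jj; apply: (@Tr_code_inj d (gs j)); [exact: Ty|exact: Ty'|].
by rewrite ny // ny'.
Qed.

(** Vectors of level [d] have at most lambda names, and one extension into [S] serves all vectors
    with the same name; so the levels needed are bounded in [K]. *)
Lemma dense_bound : exists h : K -> K, forall d y, vector d y -> exists e y',
  [/\ d <= e, e < h d, S e y', vector e y' & forall j, J j -> agree d (y' j) (y j)].
Proof.
have /boolp.choice[h hP] : forall d, exists b, forall y, vector d y -> exists e y',
    [/\ d <= e, e < b, S e y', vector e y' & forall j, J j -> agree d (y' j) (y j)].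
  move=> d.
  have /boolp.choice[f fP] : forall l, exists e, forall y, vector d y -> names d l y ->
      exists y', [/\ d <= e, S e y', vector e y' & forall j, J j -> agree d (y' j) (y j)].
    move=> l; have [[y [Ty ny]]|n] := pselect (exists y, vector d y /\ names d l y).
      have [e [y' [de Sy' Ty' yy']]] := S_dense Ty.
      exists e => y2 Ty2 ny2; exists y'; split=> // j Jj.
      by apply: agree_trans (yy' j Jj) _; exact: names_agree Ty Ty2 ny ny2 Jj.
    by exists d => y Ty ny; exfalso; apply: n; exists y.
  have [b bP] := K_Lb f; exists b => y Ty; have [l ny] := names_exists d y.
  by have [y' [? ? ? ?]] := fP l y Ty ny; exists (f l), y'.
by exists h => d y Ty; exact: hP.
Qed.

(** Makes the coordinate found by [matched] unique once the level exceeds [b]. *)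
Lemma gs_distinct : exists b, forall j j', J j -> J j' -> agree b (gs j) (gs j') -> j = j'.
Proof.
have /boolp.choice[f fP] : forall j, exists b, forall j', J j -> J j' ->
    agree b (gs j) (gs j') -> j = j'.
  move=> j.
  have /boolp.choice[f fP] : forall j', exists b, J j -> J j' ->
      agree (succ b) (gs j) (gs j') -> j = j'.
    move=> j'; have [e|n] := pselect (gs j = gs j'); first by exists k0 => Jj Jj' _; exact: gs_inj.
    have [b nb] : exists b, gs j b <> gs j' b.
      apply: contrapT => h; apply: n; apply/funext => b.
      by apply: contrapT => nb; apply: h; exists b.
    by exists b => _ _ /(_ b (lt_succ K_wo K_cb b)).
  have [b bP] := K_Lb f; exists b => j' Jj Jj' e; apply: (fP j' Jj Jj').
  by apply: agree_le e; rewrite succ_le.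
have [b bP] := K_Lb f; exists b => j j' Jj Jj' e; apply: (fP j j' Jj Jj').
exact: agree_le (ltW (bP j)) e.
Qed.

Definition named d l := exists y, [/\ S d y, vector d y & names d l y].

(** The set given to the boxed diamond: the three tags separate the values of [gs], the index set
    [J], and the names of the elements of [S]. *)
Definition guess : set K := [set k |
  [\/ exists d j, k = pi d (pr j (tag 0)) /\ gs j d,
      exists2 j, k = pi k0 (pr j (tag 1)) & J j
    | exists d l, k = pi d (pr l (tag 2)) /\ named d l]].

Lemma guess_fun_guess j d : guess (pi d (pr j (tag 0))) <-> gs j d.
Proof.
split=> [|h]; last by constructor 1; exists d, j.
case=> [[d' [j' [/piI[-> /prI[-> _]]]]]//|[j' /piI[_ /prI[_ /tag_inj]]]//|
  [d' [l [/piI[_ /prI[_ /tag_inj]]]]]] //.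
Qed.

Lemma guess_dom_guess j : guess (pi k0 (pr j (tag 1))) <-> J j.
Proof.
split=> [|h]; last by constructor 2; exists j.
case=> [[d' [j' [/piI[_ /prI[_ /tag_inj]]]]]//|[j' /piI[_ /prI[-> _]]]//|
  [d' [l [/piI[_ /prI[_ /tag_inj]]]]]] //.
Qed.

Lemma guess_set_guess d l : guess (pi d (pr l (tag 2))) <-> named d l.
Proof.
split=> [|h]; last by constructor 3; exists d, l.
case=> [[d' [j' [/piI[_ /prI[_ /tag_inj]]]]]//|[j' /piI[_ /prI[_ /tag_inj]]]//|
  [d' [l' [/piI[-> /prI[-> _]]]]]] //.
Qed.

Lemma Tr_sealing : exists a, forall y, vector a y -> S a y.
Proof.
have [h hP] := dense_bound; have [b0 b0P] := gs_distinct.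
(* The club consists of closure points of [h] and [pi], so extensions into [S] and codes for data
   below a ladder point stay below that point. *)
have [a [la DE XE na]] : exists a, [/\ limp [set: K] a,
    forall c, D a c -> Order.max b0 k0 < c /\ forall d, d < c -> h d < c /\ forall l, pi d l < c,
    X a = guess `&` below a & ~ short a].
  case: DX => _ _ hidx /(_ guess _ (pi_club h (Order.max b0 k0)))[a [la DE XE na]].
  exists a; split=> // -[l lP]; apply: (na l); exists (rk (D a)); split=> // b c; exact: rk_mono.
exists a => y Ty.
have /boolp.choice[x xP] : forall j, exists x, J j -> D a x /\
    forall c, D a c -> x <= c -> agree (next (D a) c) (y j) (walk Tr a c (gs j) (y j)).
  move=> j; have [Jj|n] := pselect (J j); last by exists k0.
  have [|x Dx xw] := @canonical_of_long a (gs j) (y j) la na.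
    by move=> b ba; exact: Tr_le (ltW ba) (Ty j Jj).
  by exists x.
have [r rP] := L_ib (fun j => rk (D a) (x j)) jb.
have /boolp.choice[dd ddP] : forall u, exists d, D a d /\ rk (D a) d = u.
  by move=> u; have [d Dd e] := rk_onto u la na; exists d.
(* The bound [r] exceeds the ranks of all starting points [x j]. At the ladder point [c] of rank
   [z], a limit point, all walks have started and the codes of all [y j] are guessed correctly. *)
have [z [lz sz Gz]] := GP (fun j u => code (dd u) (Tr (dd u) (gs j)) (y j))
  (@succ _ L) (Order.max (Order.max jb l0) r).
move: lz; rewrite !gt_max => /andP[/andP[jz l0z] rz].
have [Dc rc] := ddP z; set c := dd z in Dc rc.
have lc : limp (D a) c.
  apply: limp_of_rk => //; rewrite rc // => u uz; exists (succ u); [exact: lt_succ|exact: sz].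
have [Dn cn n_a nmin] := next_ladder la Dc; set n := next (D a) c in Dn cn n_a nmin.
have [] := DE _ Dn; rewrite gt_max => /andP[b0n k0n] nE.
set A := D a `&` below c; set B := X a `&` below n.
(* As [n] is closed under [pi], the part of [guess] below [n] already contains everything about
   levels [d < n]. *)
have BE d l : d < n -> B (pi d l) <-> guess (pi d l).
  move=> dn; have pn := (nE _ dn).2 l; rewrite /B XE; split=> [[[]]//|gp].
  by split=> //; split=> //; exact: lt_trans n_a.
have funE j : agree n (gs j) (guess_fun B j).
  move=> d dn; apply/idP/idP => [hd|/asboolW/(BE _ _ dn)/guess_fun_guess//].
  by apply/asboolP/(BE _ _ dn)/guess_fun_guess.
have domE j : guess_dom B j <-> J j by rewrite /guess_dom BE //; exact: guess_dom_guess.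
have setE d l : d < n -> guess_set B d l <-> named d l.
  by move=> dn; rewrite /guess_set BE //; exact: guess_set_guess.
have cutE d j : d <= n -> cut n Tr d (guess_fun B j) = Tr d (gs j).
  by move=> dn; rewrite /cut dn; apply/esym/Tr_local; exact: agree_le dn (funE j).
have AE d : A d -> [/\ D a d, d < c & d <= n].
  by move=> [Dd dc]; split=> //; apply: ltW; exact: lt_trans cn.
have rkA d : d <= c -> rk A d = rk (D a) d.
  move=> dc; apply: rank_ext => e ed; split=> [[]//|De]; split=> //.
  exact: lt_le_trans dc.
have codeE d j : A d -> J j -> code d (Tr d (gs j)) (y j) = G (rk A c) j (rk A d).
  move=> Ad Jj; have [Dd dc dn] := AE _ Ad; rewrite rkA // rkA ?ltW // rc.
  rewrite Gz; [|exact: lt_trans (J_lt Jj) jz|by rewrite -rc rk_mono].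
  by have [De e] := ddP (rk (D a) d); rewrite (rk_inj la De Dd e).
(* The witness extends [y] at level [c] into [S] at a level [e < n], available because [n] is closed
   under [h], and then lifts the result to level [n]. *)
have goodex : exists w, good (cut n Tr) A c n B w.
  have Tyc : vector c y by move=> j Jj; apply: Tr_le (Ty j Jj); apply: ltW; exact: lt_trans n_a.
  have [e [y' [ce eh Sy' Ty' yy']]] := hP _ _ Tyc.
  have en : e < n by apply: lt_trans eh _; exact: (nE _ cn).1.
  have /boolp.choice[w wP] : forall j, exists w, J j -> Tr n (gs j) w /\ agree e w (y' j).
    move=> j; have [Jj|nJ] := pselect (J j); last by exists (y j).
    by have [w wP] := Tr_extendible (ltW en) (Ty' j Jj); exists w.
  have [l nl] := names_exists e y'.
  exists w; split=> [j /domE Jj|].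
    have [Tw ww] := wP j Jj; rewrite cutE //; split=> // d Ad.
    have [Dd dc dn] := AE _ Ad; rewrite cutE // -codeE //; apply: code_agree.
    apply: agree_trans (agree_le _ ww) (agree_le (ltW dc) (yy' j Jj)).
    exact: le_trans (ltW dc) ce.
  exists e, l; split=> //; first by apply/setE => //; exists y'.
  move=> j /domE Jj; rewrite cutE ?ltW // -nl //; apply: code_agree.
  by have [] := wP j Jj.
have matchedE j : J j -> matched (cut n Tr) A c n B (restr n (gs j)) (restr c (y j)) j.
  move=> Jj; split; first exact/domE.
    exact: agree_trans (agree_restr _ _) (funE j).
  move=> d Ad; have [Dd dc dn] := AE _ Ad; rewrite -codeE //.
  rewrite /cut dn (Tr_local (agree_restr_le _ dn)); apply: code_agree.
  by apply: agree_restr_le; exact: ltW.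
pose V := eps (fun _ _ => false) (good (cut n Tr) A c n B).
have [V1 [e [l [en /(setE _ _ en)[w [Sw Tw nw]] V2]]]] := epsP (fun _ _ => false) goodex.
rewrite -/V in V1 V2.
have yV j : J j -> agree n (y j) (V j).
  move=> Jj; have [Dx xw] := xP j Jj.
  have xc : x j <= c.
    rewrite leNgt; apply/negP => /(rk_mono la Dc Dx); rewrite rc => /lt_trans/(_ (rP j (J_lt Jj))).
    by rewrite ltNge (ltW rz).
  have := xw c Dc xc; rewrite -/n; suff -> : walk Tr a c (gs j) (y j) = V j by [].
  rewrite /walk -/n -/A -/B /step; case: asboolP => [_|[]]; last first.
    split=> //; last by exists j; exact: matchedE.
    apply: limp_ext lc => d dc Dd; by split.
  (* The matching coordinate chosen by [step] must be [j] itself, because the functions [gs j] are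
     already distinct below [n]. *)
  have [/domE Jj' gj' _] := epsP l0 (ex_intro _ j (matchedE j Jj)).
  rewrite -/V; congr V; apply/esym/b0P => //; apply: agree_le (ltW b0n) _.
  apply: agree_trans (agree_sym (agree_restr n (gs j))) (agree_trans gj' _).
  exact: agree_sym.
have ea : e <= a by apply: ltW; exact: lt_trans n_a.
(* At level [e] the vector [V] has the name of [w] in [S], and [y] agrees with [V]; so [y] lies in
   [S] at level [e] and, by openness, at level [a]. *)
apply: S_up ea _ Ty; apply: S_agree Sw => j Jj.
apply: agree_trans (agree_sym (agree_le (ltW en) (yV j Jj))).
have [TV _] := V1 j ((domE j).2 Jj); rewrite cutE // in TV.
apply: (@Tr_code_inj e (gs j)); [exact: Tw|exact: Tr_le (ltW en) TV|].
by rewrite nw // -V2 ?domE // cutE // ltW.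
Qed.

End Sealing.

Lemma Tr_family : tree_family L Tr.
Proof.
split; first split.
- by move=> a g s t; exact: Tr_node.
- by move=> a b g t; exact: Tr_le.
- exact: Tr_not_limp.
- by move=> a b g t; exact: Tr_extendible.
- exact: Tr_full.
move=> J jb gs J_lt; split=> [a|S gs_inj S_agree S_up S_dense]; last exact: (Tr_sealing J_lt).
exists (fun y => eps l0 (fun l => names J gs a l y)) => y y' Ty Ty' e j Jj.
have ny := epsP l0 (names_exists gs J_lt a y); have ny' := epsP l0 (names_exists gs J_lt a y').
by apply: (names_agree Ty Ty' ny) => //; rewrite e.
Qed.

End Tree.

(** * Souslin trees *)

Section Height.
Context dK (K : orderType dK) (K_wo : wo K).
Context (S : rstruct) (ht : S -> K).
Context (ht_prec : forall x y : S, prec x y -> ht x < ht y).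
Context (pred_ex : forall (x : S) b, b < ht x -> exists y, prec y x /\ ht y = b).
Context (pred_uniq : forall x y z : S, prec y x -> prec z x -> ht y = ht z -> y = z).
Context (prec_trans : forall x y z : S, prec x y -> prec y z -> prec x z).

Lemma mono_ge (D : set K) (f : K -> K) :
  (forall a b, D b -> a < b -> D a) ->
  (forall a b, D a -> D b -> a < b -> f a < f b) -> forall b, D b -> b <= f b.
Proof.
move=> Ddown fm; elim/(wo_ind K_wo) => b IH Db; rewrite leNgt; apply/negP => fb.
have Df := Ddown _ _ Db fb.
by have := IH _ fb Df; rewrite leNgt fm.
Qed.

Lemma pred_lt x y z : prec y x -> prec z x -> ht y < ht z -> prec y z.
Proof.
move=> yx zx /pred_ex[w [wz e]].
by rewrite -(pred_uniq (prec_trans wz zx) yx e).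
Qed.

(** Identifies an abstract rank function with the order-type height. An isomorphism with any other
    initial segment would yield a strictly increasing map that moves some point down, against
    [mono_ge]. *)
Lemma has_heightP (x : S) (a : K) : has_height x a <-> ht x = a.
Proof.
pose g b := eps x (fun y => prec y x /\ ht y = b).
have gP b : b < ht x -> prec (g b) x /\ ht (g b) = b by move=> /pred_ex/(epsP x).
split=> [/(same_otpP x a)[f [k [fP kP fm]]]|<-]; last first.
  apply/(same_otpP x (ht x)); exists ht, g; split=> [y yx|b /gP//|y z yx zx].
    have yl := ht_prec yx; have [gy e] := gP _ yl.
    by split=> //; exact: pred_uniq gy yx e.
  by rewrite /ord_lt; split=> [|/(pred_lt yx zx)//]; exact: ht_prec.
apply/eqP; rewrite eq_le; apply/andP; split; rewrite leNgt; apply/negP => lt.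
- have [ga ea] := gP _ lt; have [fa _] := fP _ ga.
  have : a <= f (g a).
    apply: (@mono_ge (below (ht x)) (f \o g)) => //= [b c|b c /gP[gb eb] /gP[gc ec] bc].
      by move=> cx bc; exact: lt_trans cx.
    by apply/(fm _ _ gb gc); apply: pred_lt gb gc _; rewrite eb ec.
  by rewrite leNgt; move: fa; rewrite /below /= => ->.
- have [ka ea] := kP _ lt.
  have : ht x <= ht (k (ht x)).
    apply: (@mono_ge (below a) (ht \o k)) => //= [b c ca bc|b c ba ca bc].
      by exact: lt_trans ca.
    have [kb eb] := kP _ ba; have [kc ec] := kP _ ca.
    by apply: ht_prec; apply/(fm _ _ kb kc); rewrite eb ec.
  by rewrite leNgt ht_prec.
Qed.

Lemma height_not_top (x : S) :
  ~ same_otp (@prec S) [set y | prec y x] (@ord_lt _ K) [set: K].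
Proof.
move=> /(same_otpP x (ht x))[f [k [fP kP fm]]].
have [kx _] := kP (ht x) I.
have : ht x <= ht (k (ht x)).
  apply: (@mono_ge setT (ht \o k)) => //= b c _ _ bc.
  have [kb eb] := kP b I; have [kc ec] := kP c I.
  by apply: ht_prec; apply/(fm _ _ kb kc); rewrite eb ec.
by rewrite leNgt ht_prec.
Qed.

Lemma height_min (B : set S) : B !=set0 -> (exists x, B `<=` [set y | prec y x]) ->
  exists2 y, B y & forall z, B z -> z = y \/ prec y z.
Proof.
move=> [b Bb] [x Bx].
have [m [y By <-] mmin] := K_wo
  (ex_intro (fun a => exists2 y, B y & ht y = a) _ (ex_intro2 _ _ b Bb erefl)).
exists y => // z Bz; have := mmin (ht z) (ex_intro2 _ _ z Bz erefl).
rewrite le_eqVlt => /predU1P[e|lt]; last by right; apply: pred_lt lt; exact: Bx.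
by left; apply: pred_uniq (esym e); exact: Bx.
Qed.

End Height.

(** * Souslinity of posets whose nodes are represented by vectors *)

Section Represented.
Context dL (L : orderType dL) dK (K : orderType dK).
Context (K_wo : wo K) (K_cb : countably_bounded K).
Context (L_le : [set: L] #<= [set: K]) (K_notle : ~ ([set: K] #<= [set: L])).
Context (l0 : L) (k0 : K) (k0_min : forall a, k0 <= a).
Context (e : K -> K -> L) (eI : forall x c c', c <= x -> c' <= x -> e x c = e x c' -> c = c').
Context (pr : L -> L -> L) (prI : forall j u j' u', pr j u = pr j' u' -> j = j' /\ u = u').
Context (T : K -> (K -> bool) -> set (K -> bool)) (TF : tree_family L T).
Context (J : set L) (jb : L) (gs : L -> K -> bool) (J_lt : forall j, J j -> j < jb).
Context (J_ex : J !=set0) (gs_inj : forall j j', J j -> J j' -> gs j = gs j' -> j = j').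
Context (S : rstruct) (ht : S -> K) (v : S -> L -> K -> bool).

Local Notation vec a y := (forall j, J j -> T a (gs j) (y j)).
Local Notation vagree a y y' := (forall j, J j -> agree a (y j) (y' j)).

Context (v_vec : forall x, vec (ht x) (v x)).
Context (v_onto : forall a y, vec a y -> exists x, ht x = a /\ vagree a (v x) y).
Context (precP : forall x y, prec x y <-> ht x < ht y /\ vagree (ht x) (v x) (v y)).
Context (v_inj : forall x y, ht x = ht y -> vagree (ht x) (v x) (v y) -> x = y).

Let T_node : forall a g s t, agree a s t -> T a g s -> T a g t.
Proof. by case: TF => -[]. Qed.

Let T_le : forall a b g t, b <= a -> T a g t -> T b g t.
Proof. by case: TF => -[]. Qed.

Let T_nlim : forall a g t, ~ limp [set: K] a -> (forall b, b < a -> T b g t) -> T a g t.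
Proof. by case: TF => -[]. Qed.

Let T_ext : forall a b g t, b <= a -> T b g t -> exists s, T a g s /\ agree b s t.
Proof. by case: TF => -[]. Qed.

Implicit Types x y z : S.

Lemma rep_ht_prec x y : prec x y -> ht x < ht y.
Proof. by move=> /precP[]. Qed.

Lemma rep_trans x y z : prec x y -> prec y z -> prec x z.
Proof.
move=> /precP[xy axy] /precP[yz ayz]; apply/precP; split; first exact: lt_trans yz.
move=> j Jj; apply: agree_trans (axy j Jj) _; exact: agree_le (ltW xy) (ayz j Jj).
Qed.

Lemma rep_pred_ex x b : b < ht x -> exists y, prec y x /\ ht y = b.
Proof.
move=> bx; have [|y [yb ay]] := @v_onto b (v x).
  by move=> j Jj; apply: T_le (ltW bx) _; exact: v_vec.
by exists y; split=> //; apply/precP; rewrite yb.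
Qed.

Lemma rep_pred_uniq x y z : prec y x -> prec z x -> ht y = ht z -> y = z.
Proof.
move=> /precP[yx ay] /precP[zx az] e'; apply: v_inj => // j Jj.
by apply: agree_trans (ay j Jj) _; rewrite e'; apply: agree_sym; exact: az.
Qed.

Lemma rep_heightP x a : has_height x a <-> ht x = a.
Proof.
exact: (has_heightP K_wo rep_ht_prec rep_pred_ex rep_pred_uniq rep_trans).
Qed.

Lemma rep_level_ex a : exists x, ht x = a.
Proof.
have Tbot g : T k0 g (fun=> false).
  apply: T_nlim => [[[b]]|b]; by rewrite ltNge k0_min.
have /boolp.choice[y yP] : forall j, exists s, T a (gs j) s.
  by move=> j; have [s []] := T_ext (k0_min a) (Tbot (gs j)); exists s.
by have [|x [xa _]] := @v_onto a y; [move=> j _; exact: yP|exists x].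
Qed.

Lemma rep_level_code a : exists k : S -> L, forall x y, ht x = a -> ht y = a ->
  k x = k y -> x = y.
Proof.
case: TF => _ /(_ J jb gs J_lt)[/(_ a)[k kP] _].
exists (k \o v) => x y xa ya /= exy; apply: v_inj; rewrite ?xa ?ya // => j Jj.
by apply: kP exy _ Jj => i Ji; [rewrite -xa|rewrite -ya]; exact: v_vec.
Qed.

Lemma rep_kappa_tree : kappa_tree K S.
Proof.
split.
- split; first by move=> x /rep_ht_prec; rewrite ltxx.
  exact: rep_trans.
- move=> x B Bx Bn; apply: (height_min K_wo rep_pred_ex rep_pred_uniq rep_trans Bn).
  by exists x.
- move=> a; split; first by have [x xa] := rep_level_ex a; exists x; apply/rep_heightP.
  have [k kP] := rep_level_code a.
  have le : level S a #<= [set: L].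
    apply/(card_le_injP l0); exists k; split=> // x y /rep_heightP xa /rep_heightP ya.
    exact: kP.
  split; first exact: card_le_trans le L_le.
  by move=> h; apply: K_notle; exact: card_le_trans le.
- exact: (height_not_top K_wo rep_ht_prec).
Qed.

Lemma rep_sealing (P : S -> Prop) : (forall x y, prec x y -> P x -> P y) ->
  (forall x, exists y, (y = x \/ prec x y) /\ P y) ->
  exists a, forall x, ht x = a -> P x.
Proof.
move=> Pup Pdense.
pose Q d w := exists x, [/\ ht x = d, vagree d (v x) w & P x].
case: TF => _ /(_ J jb gs J_lt)[_ /(_ Q gs_inj)[]].
- move=> d y y' yy' [x [xd xy Px]]; exists x; split=> // j Jj.
  exact: agree_trans (xy j Jj) (yy' j Jj).
- move=> d a y da [x [xd xy Px]] /v_onto[x' [x'a xy']].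
  have ax j (Jj : J j) : agree d (v x j) (v x' j).
    apply: agree_trans (xy j Jj) _; apply: agree_sym; exact: agree_le da (xy' j Jj).
  exists x'; split=> //; move: da; rewrite le_eqVlt => /predU1P[dE|da].
    by rewrite -(v_inj (x := x) (y := x')) // xd ?x'a.
  by apply: Pup Px; apply/precP; rewrite xd x'a.
- move=> d y /v_onto[x [xd xy]]; have [z [xz Pz]] := Pdense x.
  have [dz az] : d <= ht z /\ vagree d (v z) (v x).
    case: xz => [->|/precP[xz az]]; first by rewrite xd.
    by rewrite -xd ltW //; split=> // j Jj; apply: agree_sym; exact: az.
  exists (ht z), (v z); split=> //; [by exists z|exact: v_vec|].
  by move=> j Jj; apply: agree_trans (az j Jj) (xy j Jj).
- move=> a aP; exists a => x xa; have [|x' [x'a xx' Px']] := aP (v x).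
    by rewrite -xa; exact: v_vec.
  by rewrite -(v_inj (x := x') (y := x)) // x'a.
Qed.

(** The complement of a cofinal branch is open, and dense by splitting; by sealing it would contain
    a whole level, which the branch must meet. *)
Lemma rep_no_branch : ~ exists B : set S, branch [set: K] B.
Proof.
move=> [B [Bchain _ Blev]].
have Bht x y : B x -> B y -> ht x = ht y -> x = y.
  by move=> Bx By e'; case: (Bchain _ _ Bx By) => // /rep_ht_prec; rewrite e' ltxx.
have [|x|a aP] := @rep_sealing (~` B).
- move=> x y xy nBx By; apply: nBx; have [x' Bx' /rep_heightP e'] := Blev (ht x) I.
  suff <- : x' = x by [].
  case: (Bchain _ _ Bx' By) => [x'y|x'y|/rep_ht_prec yx'].
  + by have := rep_ht_prec xy; rewrite -e' x'y ltxx.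
  + exact: rep_pred_uniq x'y xy e'.
  + by have := lt_trans (rep_ht_prec xy) yx'; rewrite e' ltxx.
(* Two immediate successors of [x] that differ at [ht x]; being of equal height, at most one of them
   lies on the branch. *)
- have up (b : bool) : exists y, [/\ ht y = succ (ht x), prec x y &
      forall j, J j -> v y j (ht x) = b].
    pose w j c := if c == ht x then b else v x j c.
    have wx j : agree (ht x) (v x j) (w j) by move=> c cx; rewrite /w lt_eqF.
    have [|y [yx yw]] := @v_onto (succ (ht x)) w.
      move=> j Jj; apply: T_nlim => [|c]; first exact: succ_not_limp.
      rewrite lt_succ_le // => cx; apply: T_le cx _.
      by apply: T_node (wx j) _; exact: v_vec.
    have xs := lt_succ K_wo K_cb (ht x).
    exists y; split=> //; last by move=> j Jj; rewrite (yw j Jj) // /w eqxx.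
    apply/precP; rewrite yx; split=> // j Jj.
    by apply: agree_trans (wx j) _; apply: agree_sym; exact: agree_le (ltW xs) (yw j Jj).
  have [y [yh xy vy]] := up true; have [z [zh xz vz]] := up false.
  have [j0 Jj0] := J_ex.
  have [By|nBy] := pselect (B y); last by exists y; split=> //; right.
  exists z; split; first by right.
  move=> Bz; have e' : y = z by apply: Bht => //; rewrite yh.
  by have := vy _ Jj0; rewrite e' vz.
- by have [x Bx /rep_heightP /aP] := Blev a I.
Qed.

(** The nodes above a member of [A] or incompatible with all of [A] form a dense open set, which
    contains a level [b]. No member of [A] can lie above that level, and there are at most lambda
    nodes up to it. *)
Lemma rep_no_antichain : ~ exists A : set S, antichain A /\ A #= [set: K].
Proof.
move=> [A [Aanti Acard]].
pose le x y := x = y \/ prec x y.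
have le_trans' x y z : le x y -> le y z -> le x z.
  move=> [->//|xy] [<-|yz]; first by right.
  by right; exact: rep_trans yz.
pose compat x y := exists z, le x z /\ le y z.
pose P x := (exists2 a, A a & le a x) \/ forall a, A a -> ~ compat a x.
have [|x|b bP] := @rep_sealing P.
- move=> x y xy [[a Aa ax]|h]; [left|right].
    by exists a => //; apply: le_trans' ax _; right.
  move=> a Aa [z [az yz]]; apply: (h a Aa); exists z; split=> //.
  by apply: le_trans' yz; right.
- have [[a [Aa [z [az xz]]]]|n] := pselect (exists a, A a /\ compat a x).
    by exists z; split; [case: xz => [->|]; [left|right]|left; exists a].
  by exists x; split; [left|right=> a Aa ax; apply: n; exists a].
have Ab x : A x -> ht x <= b.
  move=> Ax; rewrite leNgt; apply/negP => bx.
  have [y [yx yb]] := rep_pred_ex bx.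
  case: (bP y yb) => [[a Aa ay]|/(_ x Ax)]; last by apply; exists x; split; [left|right].
  have ax : prec a x by case: ay => [->//|ay]; exact: rep_trans yx.
  have nax : a <> x by move=> e'; have := rep_ht_prec ax; rewrite e' ltxx.
  by have [] := Aanti _ _ Aa Ax nax.
have /boolp.choice[k kP] := rep_level_code.
apply: K_notle; move: Acard; rewrite card_eq_sym card_eq_le => /andP[h _].
apply: card_le_trans h _; apply/(card_le_injP l0).
exists (fun x => pr (e b (ht x)) (k (ht x) x)); split=> // x y /Ab xb /Ab yb.
move=> /prI[/(eI xb yb) exy]; rewrite exy; exact: kP.
Qed.

Lemma rep_souslin : souslin K S.
Proof. by split; [exact: rep_kappa_tree|exact: rep_no_branch|exact: rep_no_antichain]. Qed.

End Represented.

(** * From total functions to trees of graphs and their products *)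

Section Transfer.
Context dL (L : orderType dL) dK (K : orderType dK).
Context (L_reg : regular_uncountable L) (K_succ : is_succ_cardinal L K) (L_dia : diamond L).
Context (T : K -> (K -> bool) -> set (K -> bool)) (TF : tree_family L T).

Let K_wo : wo K := succ_wo K_succ.
Let K_cb : countably_bounded K := succ_countably_bounded L_reg K_succ L_dia.

Let T_node : forall a g s t, agree a s t -> T a g s -> T a g t.
Proof. by case: TF => -[]. Qed.

Let T_le : forall a b g t, b <= a -> T a g t -> T b g t.
Proof. by case: TF => -[]. Qed.

Let T_nlim : forall a g t, ~ limp [set: K] a -> (forall b, b < a -> T b g t) -> T a g t.
Proof. by case: TF => -[]. Qed.

Definition graph (a : K) (t : K -> bool) : set (K * bool) :=
  [set p | p.1 < a /\ t p.1 = p.2].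

Lemma graph_sub a b s t : graph a s `<=` graph b t <-> a <= b /\ agree a s t.
Proof.
split=> [h|[ab ast] [c i] [/= ca <-]]; last by split=> /=; [exact: lt_le_trans ab|rewrite ast].
split; last by move=> c ca; have [|_ /= ->] := h (c, s c).
by rewrite leNgt; apply/negP => ba; have [|/=] := h (b, s b); rewrite ?ltxx.
Qed.

Lemma graph_inj a b s t : graph a s = graph b t -> a = b /\ agree a s t.
Proof.
move=> e; have /graph_sub[ab h] : graph a s `<=` graph b t by rewrite e.
have /graph_sub[ba _] : graph b t `<=` graph a s by rewrite e.
by split=> //; apply/eqP; rewrite eq_le ab.
Qed.

Lemma graph_agree a s t : agree a s t -> graph a s = graph a t.
Proof.
move=> h; apply/seteqP; split; apply/graph_sub; split=> //; exact: agree_sym.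
Qed.

Lemma graph_has_dom a b t : has_dom (graph a t) b <-> a = b.
Proof.
have e : [set p.1 | p in graph a t] = below a.
  apply/seteqP; split=> [_ [[c i] [/= ca _] <-]//|c ca].
  by exists (c, t c).
rewrite /has_dom e; split=> [h|->//].
apply/eqP; rewrite eq_le; apply/andP; split; rewrite leNgt; apply/negP => lt.
  by have : below b b; [rewrite -h|rewrite /below /= ltxx].
by have : below a a; [rewrite h|rewrite /below /= ltxx].
Qed.

Definition tset g : set (set (K * bool)) :=
  [set u | exists a t, T a g t /\ u = graph a t].

Lemma tset_rep g : exists r : tset g -> K * (K -> bool), forall x,
  T (r x).1 g (r x).2 /\ val x = graph (r x).1 (r x).2.
Proof.
suff /boolp.choice[r rP] : forall x : tset g, exists p : K * (K -> bool),
  T p.1 g p.2 /\ val x = graph p.1 p.2 by exists r.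
by move=> x; have [a [t ?]] := set_valP x; exists (a, t).
Qed.

Definition rep g : tset g -> K * (K -> bool) := sval (cid (tset_rep g)).
Definition nht g (x : tset g) : K := (rep x).1.
Definition nfun g (x : tset g) : K -> bool := (rep x).2.

Lemma repT g (x : tset g) : T (nht x) g (nfun x).
Proof. by have [] := svalP (cid (tset_rep g)) x. Qed.

Lemma repE g (x : tset g) : val x = graph (nht x) (nfun x).
Proof. by have [] := svalP (cid (tset_rep g)) x. Qed.

Lemma node_ex g a t : T a g t -> exists x : tset g, nht x = a /\ agree a (nfun x) t.
Proof.
move=> Tt; have ut : tset g (graph a t) by exists a, t.
exists (SigSub (mem_set ut)); have := repE (SigSub (mem_set ut) : tset g).
move=> /= /esym/graph_inj[e h]; split=> //; apply: agree_le h.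
by rewrite le_eqVlt e eqxx.
Qed.

Lemma node_inj g (x y : tset g) : nht x = nht y -> agree (nht x) (nfun x) (nfun y) -> x = y.
Proof. by move=> e h; apply: val_inj; rewrite !repE -e; exact: graph_agree. Qed.

Lemma node_precP g (x y : inclusion_order (tset g)) :
  prec x y <-> nht x < nht y /\ agree (nht x) (nfun x) (nfun y).
Proof.
rewrite /prec /= properEneq !repE; split=> [[/eqP n /graph_sub[le h]]|[lt h]].
  split=> //; rewrite lt_neqAle le andbT; apply/eqP => e; apply: n.
  by rewrite -e; exact: graph_agree.
split; last by apply/graph_sub; split=> //; exact: ltW.
by apply/eqP => /graph_inj[e _]; rewrite e ltxx in lt.
Qed.

Lemma rep_data : exists (l0 : L) (k0 : K) (e : K -> K -> L) (pr : L -> L -> L),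
  [/\ forall a, k0 <= a,
      forall x c c', c <= x -> c' <= x -> e x c = e x c' -> c = c'
    & forall j u j' u', pr j u = pr j' u' -> j = j' /\ u = u'].
Proof.
have [l0 _] := regular_bot L_reg.
have [k0 k0P] := succ_bot K_succ.
have [pr prI] := diamond_pairing L_reg L_dia.
have [e eI] := succ_code L_reg K_succ L_dia.
by exists l0, k0, e, pr.
Qed.

Lemma tset_heightP g (x : inclusion_order (tset g)) (a : K) : has_height x a <-> nht x = a.
Proof.
have [l0 _] := regular_bot L_reg.
(* A single tree is treated as the product over the one-element index set [[set l0]]. *)
apply: (@rep_heightP _ L _ K K_wo T TF [set l0] (fun=> g) (inclusion_order (tset g))
  (@nht g) (fun x _ => nfun x)).
- by move=> y j _; exact: repT.
- move=> b y /(_ l0 erefl)/node_ex[z [zb zy]]; exists z; split=> // j; by move=> ->.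
- move=> y z; split=> [/node_precP[yz h]|[yz h]]; first by split.
  by apply/node_precP; split=> //; exact: (h l0).
- by move=> y z e /(_ l0 erefl); exact: node_inj.
Qed.

Lemma tset_souslin g : souslin K (inclusion_order (tset g)).
Proof.
have [l0 [k0 [e [pr [k0P eI prI]]]]] := rep_data.
have le : [set: L] #<= [set: K] by case: K_succ => _ [].
have [jb jbP] := no_max (regular_countably_bounded L_reg) l0.
apply: (@rep_souslin _ L _ K K_wo K_cb le (succ_not_le K_succ) l0 k0 k0P e eI pr prI
  T TF [set l0] jb (fun=> g) _ _ _ (inclusion_order (tset g)) (@nht g) (fun x _ => nfun x)).
- by move=> j ->.
- by exists l0.
- by move=> j j' -> ->.
- by move=> y j _; exact: repT.
- move=> b y /(_ l0 erefl)/node_ex[z [zb zy]]; exists z; split=> // j; by move=> ->.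
- move=> y z; split=> [/node_precP[yz h]|[yz h]]; first by split.
  by apply/node_precP; split=> //; exact: (h l0).
- by move=> y z e' /(_ l0 erefl); exact: node_inj.
Qed.

Lemma tset_splitting g : splitting_binary_tree (tset g).
Proof.
split; first by have [] := tset_souslin g.
- move=> _ [a [t [_ ->]]]; split=> [b i j [/= _ <-] [/= _ <-]//|].
  by exists a; apply/graph_has_dom.
- move=> _ b [a [t [Tt ->]]]; exists (Order.min a b), t; split.
    by apply: T_le Tt; rewrite ge_min lexx.
  apply/seteqP; split=> -[c i] /=.
    by move=> [[/= ca <-] cb]; split=> //=; rewrite lt_min ca.
  by move=> [/=]; rewrite lt_min => /andP[ca cb] <-.
- move=> _ a [a' [t [Tt ->]]] /graph_has_dom e; rewrite e in Tt *.
  suff h i : tset g (graph a t `|` [set (a, i)]) by split; exact: h.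
  pose t' c := if c == a then i else t c.
  have tt' : agree a t t' by move=> c ca; rewrite /t' lt_eqF.
  exists (succ a), t'; split.
    apply: T_nlim => [|c]; first exact: succ_not_limp.
    by rewrite lt_succ_le // => ca; apply: T_le ca _; exact: T_node tt' Tt.
  apply/seteqP; split=> -[c j] /=.
    move=> [[/= ca <-]|[-> ->]]; last by split=> /=; [exact: lt_succ|rewrite /t' eqxx].
    by split=> /=; [exact: lt_trans (lt_succ K_wo K_cb a)|rewrite -tt'].
  move=> [/=]; rewrite lt_succ_le // le_eqVlt => /predU1P[-> <-|ca <-].
    by right; rewrite /t' eqxx.
  by left; split=> //=; rewrite tt'.
Qed.

(** The union of a branch of limit length is a function [s], whose value at [c] is read from the
    node of height [succ c]. *)
Lemma branch_fun g a (B : set (inclusion_order (tset g))) : limp [set: K] a ->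
  branch (below a) B -> exists s, (forall b, b < a -> T b g s) /\
    forall x, B x <-> nht x < a /\ val x = graph (nht x) s.
Proof.
move=> la [Bchain Bht Blev].
have slt c : c < a -> succ c < a.
  by move=> /la.2[d [_ cd da]]; apply: le_lt_trans da; rewrite succ_le.
have [x0 Bx0] : exists x, B x by have [[b ba] _] := la; have [x Bx _] := Blev b ba; exists x.
have /boolp.choice[f fP] : forall b, exists x, b < a -> B x /\ nht x = b.
  move=> b; have [ba|_] := ltP b a; last by exists x0.
  by have [x Bx /tset_heightP xb] := Blev b ba; exists x.
pose s c := nfun (f (succ c)) c.
have Bs x : B x -> agree (nht x) (nfun x) s.
  move=> Bx c cx; have [_ [b ba /tset_heightP xb]] := (Bx, Bht _ Bx).
  have ca : c < a by apply: lt_trans cx _; rewrite xb.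
  have [Bf fE] := fP _ (slt _ ca).
  case: (Bchain _ _ Bx Bf) => [e|/node_precP[_ h]|/node_precP[_]]; first by rewrite /s -e.
    exact: h.
  by rewrite fE => h; rewrite /s h // lt_succ.
have BT x : B x -> nht x < a by move=> /Bht[b ba /tset_heightP ->].
exists s; split=> [b ba|x].
  have [Bf fE] := fP b ba; rewrite -fE; apply: T_node (repT _); exact: Bs.
split=> [Bx|[xa xE]].
  by split; [exact: BT|rewrite repE; apply: graph_agree; exact: Bs].
have [Bf fE] := fP _ xa; suff <- : f (nht x) = x by [].
by apply: val_inj; rewrite xE repE fE; apply: graph_agree; rewrite -[X in agree X]fE; exact: Bs.
Qed.

Lemma tset_full g : full K (inclusion_order (tset g)).
Proof.
move=> a /limit_pointP la B B' hB vB hB' vB'.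
have [s [Ts sE]] := branch_fun la hB; have [s' [Ts' sE']] := branch_fun la hB'.
have nT (C : set (inclusion_order (tset g))) t :
    (forall x, C x <-> nht x < a /\ val x = graph (nht x) t) ->
    vanishing C -> ~ T a g t.
  move=> CE vC /node_ex[y [ya yt]]; apply: vC; exists y => x /CE[xa xE]; right.
  apply/node_precP; rewrite ya; split=> //.
  have [_ h] := graph_inj (etrans (esym (repE x)) xE).
  by apply: agree_trans h _; apply: agree_sym; exact: agree_le (ltW xa) yt.
have ss' : agree a s s'.
  by case: TF => -[_ _ _ _ Tfull] _; apply: Tfull (nT _ _ sE vB) (nT _ _ sE' vB').
apply/seteqP; split=> x; rewrite sE sE' => -[xa ->]; split=> //; apply: graph_agree;
  [exact: agree_le (ltW xa) ss'|exact: agree_sym (agree_le (ltW xa) ss')].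
Qed.

(** The index set [I] is moved into [L] by an injection [io], whose image is bounded by regularity;
    distinct indices keep distinct functions, as sealing requires. *)
Lemma product_souslin M (h : M -> K -> bool) (I : set M) :
  (forall i i', h i = h i' -> i = i') -> I !=set0 -> card_lt I [set: L] ->
  souslin K (product K (fun i : I => inclusion_order (tset (h (val i))))).
Proof.
move=> hI [i1 Ii1] cI; set P := product _ _.
pose i0 : I := SigSub (mem_set Ii1).
have [l0 [k0 [e [pr [k0P eI prI]]]]] := rep_data.
have le : [set: L] #<= [set: K] by case: K_succ => _ [].
have [io [_ ioI]] := (card_le_injP l0 I [set: L]).1 cI.1.
have [jb jbP] := regular_bounded L_reg io cI.
pose inv l : I := eps i0 (fun i : I => io (val i) = l).
have invE (i : I) : inv (io (val i)) = i.
  apply: val_inj; apply: ioI; [exact: set_valP|exact: set_valP|].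
  exact: (epsP i0 (ex_intro (fun j : I => io (val j) = io (val i)) i erefl)).
pose J : set L := [set l | exists i : I, l = io (val i)].
pose ht (s : P) : K := nht (val s i0).
have htE (s : P) i : nht (val s i) = ht s.
  have [a sa] : exists a : K, forall j, level (inclusion_order (tset (h (val j)))) a (val s j).
    exact: (set_valP s).
  by rewrite /ht; have /tset_heightP -> := sa i; have /tset_heightP -> := sa i0.
apply: (@rep_souslin _ L _ K K_wo K_cb le (succ_not_le K_succ) l0 k0 k0P e eI pr prI
  T TF J jb (fun l => h (val (inv l))) _ _ _ P ht (fun s l => nfun (val s (inv l)))).
- by move=> _ [i ->]; apply: jbP; exact: set_valP.
- by exists (io (val i0)), i0.
- by move=> _ _ [i ->] [i' ->]; rewrite !invE => /hI ->.
- by move=> s _ [i ->]; rewrite -(htE s (inv (io (val i)))); exact: repT.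
- move=> a y Ty.
  have ex (i : I) : exists x : tset (h (val i)), nht x = a /\ agree a (nfun x) (y (io (val i))).
    by apply: node_ex; have := Ty (io (val i)); rewrite invE; apply; exists i.
  pose s (i : I) : inclusion_order (tset (h (val i))) := sval (cid (ex i)).
  have sP i : nht (s i) = a /\ agree a (nfun (s i)) (y (io (val i))) := svalP (cid (ex i)).
  have sl : [set s : forall i : I, inclusion_order (tset (h (val i))) |
      exists b : K, forall i, level (inclusion_order (tset (h (val i)))) b (s i)] s.
    by exists a => i; apply/tset_heightP; exact: (sP i).1.
  exists (SigSub (mem_set sl) : P); split; first exact: (sP i0).1.
  by move=> _ [i ->] /=; rewrite invE; exact: (sP i).2.
- move=> s t; split=> [st|[st a] i].
    have st' i := (node_precP (val s i) (val t i)).1 (st i).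
    split; first exact: (st' i0).1.
    by move=> _ [i ->]; rewrite invE -(htE s i); exact: (st' i).2.
  apply/node_precP; rewrite !htE; split=> //.
  by have := a (io (val i)); rewrite invE; apply; exists i.
- move=> s t st a; apply: val_inj; apply: functional_extensionality_dep => i.
  apply: node_inj; rewrite !htE //.
  by have := a (io (val i)); rewrite invE; apply; exists i.
Qed.

End Transfer.

(** * Assembly of the construction and the final family *)

Lemma tree_family_exists dL (L : orderType dL) dK (K : orderType dK) :
  regular_uncountable L -> is_succ_cardinal L K -> diamond L -> boxed_diamond L K ->
  exists T : K -> (K -> bool) -> set (K -> bool), tree_family L T.
Proof.
move=> L_reg K_succ L_dia K_box.
have [D [X DX]] := ladder_exists L_reg K_succ K_box.
have [l0 _] := regular_bot L_reg.
have [k0 _] := succ_bot K_succ.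
have [G GP] := diamond2 L_reg L_dia.
have [pr prI] := diamond_pairing L_reg L_dia.
have [pi piI] := succ_pairing L_reg K_succ L_dia DX.
exists (Tr (succ_wo K_succ) l0 k0 G pi pr D X); apply: Tr_family => //.
- exact: regular_wo.
- exact: regular_countably_bounded.
- exact: succ_countably_bounded L_reg K_succ L_dia.
- exact: regular_initially_bounded.
- exact: succ_bounded L_reg K_succ L_dia.
- exact: (pairing_closure_club L_reg K_succ L_dia).
Qed.

Theorem theorem3 (dL : Order.disp_t) (L : orderType dL)
    (dK : Order.disp_t) (K : orderType dK)
    (dM : Order.disp_t) (M : orderType dM)
    (hL : regular_uncountable L)
    (hK : is_succ_cardinal L K)
    (hM : is_power_cardinal K M)
    (hdiamond : diamond L)
    (hbox : boxed_diamond L K) :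
  exists T : M -> set (set (K * bool)),
    (forall i : M,
       [/\ splitting_binary_tree (T i),
           full K (inclusion_order (T i))
         & souslin K (inclusion_order (T i))]) /\
    (forall I : set M, (I !=set0)%classic -> card_lt I [set: L]%classic ->
       souslin K (product K (fun i : I => inclusion_order (T (val i))))).
Proof.
have [T TF] := tree_family_exists hL hK hdiamond hbox.
(* An injection of the index set into the functions [K -> bool] selects the tree attached to each
   index. *)
have [h hI] : exists h : M -> K -> bool, forall i i', h i = h i' -> i = i'.
  case: hM => _; rewrite card_eq_le => /andP[/(card_le_injP (fun=> false))[h [_ hI]] _].
  by exists h => i i'; exact: hI.
exists (fun i => tset T (h i)); split=> [i|I I_ex I_lt].
- split; [exact: tset_splitting hL hK hdiamond _ TF _|exact: tset_full hL hK hdiamond _ TF _|].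
  exact: tset_souslin hL hK hdiamond _ TF _.
- exact: (product_souslin hL hK hdiamond TF).
Qed.
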